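(* Suppose each $f_{i,t}$ is convex, Assumptions 1–5 of the context hold, and $\{x_{i,t}\}$ is generated by the ODCSGD algorithm of the context with $\lambda_t=2B_gt^{\alpha}$ and $\eta_t=\frac{1}{(at+b)^{\kappa}}$, where $\kappa=\frac{p+1}{2p}$ and $\alpha=\frac{1}{2p}$. Then for any $\delta\in(0,1)$, with probability at least $1-\delta$, $$\boldsymbol{REG}_T^d=\mathcal O\!\left(T^{\frac{1+p}{2p}}\Big(1+C_T+\log\frac1\delta\Big)\right),$$ i.e. there is a constant $K$ independent of $T$ and $\delta$ such that, for every $T\ge 1$ and every $\delta\in(0,1)$, with probability at least $1-\delta$, $\boldsymbol{REG}_T^d\le K\,T^{\frac{1+p}{2p}}\big(1+C_T+\log\frac1\delta\big)$.
   Context: Setting: $N$ agents $\mathcal V=[N]=\{1,\dots,N\}$, horizon $T\in\mathbb N$, differentiable costs $f_{i,t}:\mathbb R^d\to\mathbb R$, $f_t=\sum_{i=1}^N f_{i,t}$. $\|\cdot\|$ is the 2-norm. $x_t^*$ is a minimizer of $f_t$ over $\mathbb R^d$ (assumed to exist). Path length: $C_T=\sum_{t=2}^T\|x_t^*-x_{t-1}^*\|$. Dynamic regret: $\boldsymbol{REG}_T^d=\sum_{i=1}^N\sum_{t=1}^T\big(f_t(x_{i,t})-f_t(x_t^* )\big)$. Algorithm (ODCSGD): from initial states $x_{i,1}\in\mathbb R^d$, $y_{i,t}=\sum_{j=1}^N[W_t]_{ij}x_{j,t}$, $\ \widetilde\nabla f_{i,t}(x_{i,t})=\mathrm{clip}_{\lambda_t}(\widehat\nabla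 f_{i,t}(x_{i,t}))$, $\ x_{i,t+1}=y_{i,t}-\eta_t\widetilde\nabla f_{i,t}(x_{i,t})$, where $\mathrm{clip}_{\lambda}(y)=\min\{1,\lambda/\|y\|\}\,y$ (and $\mathrm{clip}_\lambda(0)=0$), $\widehat\nabla f_{i,t}$ is a random (noisy) gradient, $\lambda_t>0$ are clipping levels, and $\{\eta_t\}$ is a positive non-increasing step size sequence; in $\eta_t=(at+b)^{-\kappa}$, $a>0$ and $b\ge0$ are constants. $\bar x_t=\frac1N\sum_{i=1}^N x_{i,t}$. $\mathcal F_t$ denotes the $\sigma$-field generated by the gradient estimators of rounds $1,\dots,t-1$; $x_{i,t}$ is $\mathcal F_t$-measurable. Assumption 1: $\mathbb E[\widehat\nabla f_{i,t}(x)\mid x]=\nabla f_{i,t}(x)$ for all $x\in\mathbb R^d$ and all $i$. Assumption 2 (heavy-tailed noise): $\mathbb E[\|\widehat\nabla f_{i,t}(x)-\nabla f_{i,t}(x)\|^p\mid x]\le\sigma^p$ for all $x$ and all $i$, for some $\sigma>0$ and $p\in(1,2]$. In Assumptions 1–2, at the query point $x=x_{i,t}$ of round $t$ conditioning is understood as conditioning on $\mathcal F_t$. Assumption 3: each $f_{i,t}$ is $L$-smooth: $\|\nabla f_{i,t}(x)-\nabla f_{i,t}(y)\|\le L\|x-y\|$ for all $x,y$ (hence $f_{i,t}(y)\le f_{i,t}(x)+\langle\nabla f_{i,t}(x),y-x\rangle+\frac L2\|y-x\|^2$). Assumption 4: there are $B_X>0$, $B_g>0$ such that almost surely, for all $i,t$,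 $\|x_{i,t}\|\le B_X$, $\|\nabla f_{i,t}(x_{i,t})\|\le B_g$ and $\|\nabla f_{i,t}(\bar x_t)\|\le B_g$. Assumption 5: the directed graphs $\mathcal G_t=(\mathcal V,W_t,\mathcal E_t)$, $t\ge1$, with $\mathcal N_{i,t}=\{j:(i,j)\in\mathcal E_t\}\cup\{i\}$, satisfy: (a) there is $\eta\in(0,1)$ with $[W_t]_{ij}\ge\eta$ if $j\in\mathcal N_{i,t}$ and $[W_t]_{ij}=0$ otherwise; (b) $W_t$ is doubly stochastic; (c) there is an integer $B>0$ such that $(\mathcal V,\bigcup_{l=0}^{B-1}\mathcal E_{t+l})$ is strongly connected for every $t\ge1$. The constants $N,\sigma,p,L,B_X,B_g,\eta,B,a,b$ do not depend on $T$ or $\delta$. *)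

(* Defs.v *)
(* MathComp / MathComp-Analysis development.
   Rounds are numbered from 1: sequences are indexed by [nat], and their values
   at index 0 are never used. *)
From HB Require Import structures.
From mathcomp Require Import all_boot all_order all_algebra.
From mathcomp Require Import all_classical all_reals all_analysis.

Set Implicit Arguments.
Unset Strict Implicit.
Unset Printing Implicit Defensive.

Import Order.TTheory GRing.Theory Num.Theory.
Import numFieldNormedType.Exports.

Local Open Scope classical_set_scope.
Local Open Scope ring_scope.

(* The library norm [`|x|] on ['rV[R]_d] is the sup norm, hence this definition.
   Differentiability does not depend on the choice between the two. *)
Definition enorm (R : realType) (d : nat) (x : 'rV[R]_d) : R :=
  Num.sqrt (\sum_k x 0 k ^+ 2).

Definition grad (R : realType) (d : nat) (f : 'rV[R]_d -> R) (x : 'rV[R]_d) :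
  'rV[R]_d := \row_k 'D_(delta_mx 0 k) f x.

(* Since [l / 0 = 0], [clip l 0 = 0]. *)
Definition clip (R : realType) (d : nat) (l : R) (y : 'rV[R]_d) : 'rV[R]_d :=
  Num.min 1 (l / enorm y) *: y.

Section conditional_expectation.
Context (disp : measure_display) (Omega : measurableType disp) (R : realType).
Variable P : probability Omega R.

(* [Y] is a version of E[X | F]; meant for [F] a sub-sigma-field of the
   measurable sets. *)
Definition is_cond_exp (F : set (set Omega)) (X Y : Omega -> R) : Prop :=
  [/\ P.-integrable setT (EFin \o X),
      P.-integrable setT (EFin \o Y),
      (forall B : set R, measurable B -> F (Y @^-1` B)) &
      (forall A : set Omega, F A ->
         (\int[P]_(w in A) (X w)%:E = \int[P]_(w in A) (Y w)%:E)%E)].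

End conditional_expectation.

Section online_optimization.
Context (R : realType) (N d : nat).
Implicit Types (f : 'I_N -> nat -> 'rV[R]_d -> R) (xstar : nat -> 'rV[R]_d).

Definition total_cost f (t : nat) (x : 'rV[R]_d) : R := \sum_(i < N) f i t x.

Definition is_minimizer (h : 'rV[R]_d -> R) (z : 'rV[R]_d) : Prop :=
  forall x, h z <= h x.

Definition path_length xstar (T : nat) : R :=
  \sum_(2 <= t < T.+1) enorm (xstar t - xstar t.-1).

Definition dynamic_regret f xstar (x : 'I_N -> nat -> 'rV[R]_d) (T : nat) : R :=
  \sum_(i < N) \sum_(1 <= t < T.+1)
    (total_cost f t (x i t) - total_cost f t (xstar t)).

Definition average (x : 'I_N -> 'rV[R]_d) : 'rV[R]_d :=
  N%:R^-1 *: \sum_(i < N) x i.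

Definition L_smooth (L : R) (h : 'rV[R]_d -> R) : Prop :=
  forall x y, enorm (grad h x - grad h y) <= L * enorm (x - y).

(* [E t i j] means that (i, j) is an edge of the graph of round [t]. *)
Definition in_nbhd (E : nat -> rel 'I_N) (t : nat) (i j : 'I_N) : bool :=
  E t i j || (j == i).

Definition doubly_stochastic (W : 'M[R]_N) : Prop :=
  [/\ forall i j, 0 <= W i j,
      forall i, \sum_j W i j = 1 &
      forall j, \sum_i W i j = 1].

Definition union_edges (E : nat -> rel 'I_N) (t B : nat) : rel 'I_N :=
  [rel i j | [exists l : 'I_B, E (t + l)%N i j]].

Definition strongly_connected (e : rel 'I_N) : Prop :=
  forall i j, connect e i j.

Definition network_assumption (W : nat -> 'M[R]_N) (E : nat -> rel 'I_N)
    (theta : R) (B : nat) : Prop :=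
  [/\ forall t, (1 <= t)%N -> forall i j,
        if in_nbhd E t i j then theta <= W t i j else W t i j == 0,
      forall t, (1 <= t)%N -> doubly_stochastic (W t) &
      forall t, (1 <= t)%N -> strongly_connected (union_edges E t B)].

End online_optimization.

Section odcsgd.
Context (disp : measure_display) (Omega : measurableType disp) (R : realType).
Context (N d : nat).
Implicit Types (P : probability Omega R) (f : 'I_N -> nat -> 'rV[R]_d -> R).
(* [ghat i t z w] is the noisy gradient returned to agent [i] in round [t] at
   the query point [z], for the outcome [w]; [x i t w] is the state. *)
Implicit Types (ghat : 'I_N -> nat -> 'rV[R]_d -> Omega -> 'rV[R]_d)
               (x : 'I_N -> nat -> Omega -> 'rV[R]_d).

Definition is_odcsgd (W : nat -> 'M[R]_N) (lam eta : nat -> R) ghat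
    (x1 : 'I_N -> 'rV[R]_d) x : Prop :=
  (forall i w, x i 1 w = x1 i) /\
  (forall i t w, (1 <= t)%N ->
     x i t.+1 w = \sum_(j < N) W t i j *: x j t w
                  - eta t *: clip (lam t) (ghat i t (x i t w) w)).

(* The sigma-field F_t generated by the coordinates of the random vectors
   [ghat i s (x i s)], for all agents [i] and all rounds [1 <= s < t]. *)
Definition past ghat x (t : nat) : set (set Omega) :=
  <<s [set A | exists i s k, (1 <= s < t)%N /\
         preimage_set_system setT (fun w => ghat i s (x i s w) w 0 k)
           measurable A] >>.

(* At a deterministic point [z], conditioning on [z] is void. *)
Definition unbiased P f ghat x : Prop :=
  forall i t, (1 <= t)%N ->
    (forall (z : 'rV[R]_d) k,
       P.-integrable setT (EFin \o (fun w => ghat i t z w 0 k)) /\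
       'E_P[(fun w => ghat i t z w 0 k)%R]%E = (grad (f i t) z 0 k)%:E) /\
    (forall k, is_cond_exp P (past ghat x t)
       (fun w => ghat i t (x i t w) w 0 k)
       (fun w => grad (f i t) (x i t w) 0 k)).

Definition heavy_tailed_noise P (sigma p : R) f ghat x : Prop :=
  forall i t, (1 <= t)%N ->
    (forall z : 'rV[R]_d,
       ('E_P[(fun w => enorm (ghat i t z w - grad (f i t) z) `^ p)%R]
         <= (sigma `^ p)%:E)%E) /\
    (exists2 Y : Omega -> R,
       is_cond_exp P (past ghat x t)
         (fun w => enorm (ghat i t (x i t w) w - grad (f i t) (x i t w)) `^ p) Y &
       {ae P, forall w, Y w <= sigma `^ p}).

Definition bounded_assumption P (BX Bg : R) f x : Prop :=
  {ae P, forall w, forall i t, (1 <= t)%N ->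
    [/\ enorm (x i t w) <= BX,
        enorm (grad (f i t) (x i t w)) <= Bg &
        enorm (grad (f i t) (average (fun j => x j t w))) <= Bg]}.

End odcsgd.

(* Main.v *)
(* Linearizing the convex costs at the states of the agents, the regret splits into
   a tracking part, governed by the clipped gradients, and the noise
   [sum_t sum_j <grad f_{j,t}(x_{j,t}) - clipped gradient, x_{j,t} - xstar_t>].

   For the tracking part, the agents reach consensus at a geometric rate, so the
   sum of the spreads of their states is of the order of the sum of the drifts
   [eta_t lam_t = O(t^(-1/2))], and the average state performs inexact gradient descent.  The minimizers are not
   assumed to be bounded: the telescoping is done with [|y|^2 / 2 - <y, xstar_t>],
   which is affine in [xstar_t], so that the bound stays linear in the path length.

   For the noise, clipping costs a conditional bias [O(lam_t^(1-p))] and a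
   conditional variance [O(lam_t^(2-p))]; an exponential supermartingale and Markov's
   inequality then give the tail.  The factor [xstar_t] makes this bound too weak when
   the path length exceeds [T^(1-kap)]; in that case the part of the regret that
   depends on the minimizers is essentially the same for all outcomes, since the
   states are bounded, and a bound in mean is enough. *)
Require Import Defs.
From HB Require Import structures.
From mathcomp Require Import all_boot all_order all_algebra.
From mathcomp Require Import all_classical all_reals all_analysis.
From mathcomp Require Import measurable_realfun ring lra.

Set Implicit Arguments.
Unset Strict Implicit.
Unset Printing Implicit Defensive.

Import Order.TTheory GRing.Theory Num.Theory.
Import numFieldNormedType.Exports.

Local Open Scope classical_set_scope.
Local Open Scope ring_scope.

(** Why the exponents balance: write alp = 1 / (2 * p), so that kap = alp + 1/2. Then 1 / eta_T,
    lam_T * sqrt T and the summed bias, of lam_t^(1-p), are all of order T^kap. The summed variance,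
    of lam_t^(2-p), has the larger order T^(kap + alp). The term log(1/delta) / mu of the tail bound
    calls for mu of order T^(-kap). With Y = 1 + C_T bounding the distances to the minimizers up to
    a constant, the exponential moment then asks that mu * lam_T * Y stay bounded and that mu * Y^2
    * T^(kap + alp) be O(T^kap * Y); both hold as soon as Y <= T^(1/2). The argument in mean works
    once T^kap * Y >= T, that is, Y >= T^(1/2 - alp). These ranges overlap, and the case split sits
    at T^(1/2 - alp) = T^(1 - kap). Every constant is chosen before the outcome: the tracking
    estimates are stated for deterministic trajectories whose update directions are only known to be
    bounded by the clipping levels. *)

Section euclidean.
Context (R : realType) (d : nat).
Implicit Types (u v w : 'rV[R]_d) (c l : R).

(** * Euclidean inner product and norm *)

Definition dotv u v : R := \sum_k u 0 k * v 0 k.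

Lemma dotvC u v : dotv u v = dotv v u.
Proof. by apply: eq_bigr => k _; rewrite mulrC. Qed.

Lemma dotvDl u v w : dotv (u + v) w = dotv u w + dotv v w.
Proof.
rewrite /dotv -big_split; apply: eq_bigr => k _.
by rewrite !mxE mulrDl.
Qed.

Lemma dotvZl c u v : dotv (c *: u) v = c * dotv u v.
Proof. by rewrite /dotv mulr_sumr; apply: eq_bigr => k _; rewrite mxE mulrA. Qed.

Lemma dotvNl u v : dotv (- u) v = - dotv u v.
Proof. by rewrite -scaleN1r dotvZl mulN1r. Qed.

Lemma dotvBl u v w : dotv (u - v) w = dotv u w - dotv v w.
Proof. by rewrite dotvDl dotvNl. Qed.

Lemma dotvDr u v w : dotv w (u + v) = dotv w u + dotv w v.
Proof. by rewrite dotvC dotvDl !(dotvC w). Qed.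

Lemma dotvBr u v w : dotv w (u - v) = dotv w u - dotv w v.
Proof. by rewrite dotvC dotvBl !(dotvC w). Qed.

Lemma dotvZr c u v : dotv u (c *: v) = c * dotv u v.
Proof. by rewrite dotvC dotvZl dotvC. Qed.

Lemma dotv0l u : dotv 0 u = 0.
Proof. by rewrite /dotv big1 // => k _; rewrite mxE mul0r. Qed.

Lemma dotv_suml (I : finType) (F : I -> 'rV[R]_d) v :
  dotv (\sum_i F i) v = \sum_i dotv (F i) v.
Proof.
apply: (big_morph (fun u => dotv u v)) => [u w|]; first exact: dotvDl.
exact: dotv0l.
Qed.

Lemma dotvv_ge0 u : 0 <= dotv u u.
Proof. by apply: sumr_ge0 => k _; rewrite -expr2 sqr_ge0. Qed.

Lemma enorm_ge0 u : 0 <= enorm u.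
Proof. exact: sqrtr_ge0. Qed.

Lemma sqr_enorm u : enorm u ^+ 2 = dotv u u.
Proof.
rewrite sqr_sqrtr; first by apply: eq_bigr => k _; rewrite expr2.
by apply: sumr_ge0 => k _; exact: sqr_ge0.
Qed.

Lemma enorm0_eq0 u : enorm u = 0 -> u = 0.
Proof.
move=> u0; have := sqr_enorm u; rewrite u0 expr0n /= => /esym/eqP.
rewrite psumr_eq0; last by move=> k _; rewrite -expr2 sqr_ge0.
move=> /allP h; apply/rowP => k; rewrite mxE.
have /= := h k (mem_index_enum k).
by rewrite mulf_eq0 orbb => /eqP.
Qed.

Lemma enorm0 : enorm (0 : 'rV[R]_d) = 0.
Proof. by rewrite /enorm big1 ?sqrtr0// => k _; rewrite mxE expr0n. Qed.

Lemma enormZ c u : enorm (c *: u) = `|c| * enorm u.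
Proof.
apply/eqP; rewrite -(eqrXn2 (n:=2)) ?enorm_ge0 ?mulr_ge0 ?enorm_ge0//.
by rewrite exprMn !sqr_enorm dotvZl dotvZr mulrA real_normK ?num_real// expr2.
Qed.

Lemma enormN u : enorm (- u) = enorm u.
Proof. by rewrite -scaleN1r enormZ normrN1 mul1r. Qed.

Lemma enormBC u v : enorm (u - v) = enorm (v - u).
Proof. by rewrite -enormN opprB. Qed.

(** Cauchy-Schwarz: the squared norm of [enorm v *: u - enorm u *: v] is [2 * e * (e - dotv u v)],
    where [e] is the product of the norms and can be cancelled when positive. *)
Lemma dotv_le u v : dotv u v <= enorm u * enorm v.
Proof.
have [u0|u0] := eqVneq (enorm u) 0.
  by rewrite u0 mul0r (enorm0_eq0 u0) dotv0l.
have [v0|v0] := eqVneq (enorm v) 0.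
  by rewrite v0 mulr0 (enorm0_eq0 v0) dotvC dotv0l.
have p : 0 < enorm u * enorm v.
  by rewrite mulr_gt0// lt_def ?u0 ?v0 enorm_ge0.
have := dotvv_ge0 (enorm v *: u - enorm u *: v).
rewrite dotvBl !dotvBr !dotvZl !dotvZr -!sqr_enorm (dotvC v u).
move: p; set e := enorm u * enorm v => p h.
have : 0 <= e * (e - dotv u v) by move: h; rewrite /e; lra.
by rewrite pmulr_rge0// subr_ge0.
Qed.

Lemma dotv_abs_le u v : `|dotv u v| <= enorm u * enorm v.
Proof.
rewrite ler_norml dotv_le andbT lerNl -dotvNl -(enormN u); exact: dotv_le.
Qed.

Lemma ler_enormD u v : enorm (u + v) <= enorm u + enorm v.
Proof.
rewrite -(ler_pXn2r (n:=2)) ?nnegrE ?addr_ge0 ?enorm_ge0//.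
rewrite sqrrD !sqr_enorm dotvDl !dotvDr (dotvC v u).
by have := dotv_le u v; lra.
Qed.

Lemma ler_enormB u v : enorm (u - v) <= enorm u + enorm v.
Proof. by rewrite -(enormN v) ler_enormD. Qed.

Lemma ler_enorm_sum (I : finType) (F : I -> 'rV[R]_d) :
  enorm (\sum_i F i) <= \sum_i enorm (F i).
Proof.
elim/big_ind2 : _ => [|u x v y ux vy|//]; first by rewrite enorm0.
by rewrite (le_trans (ler_enormD _ _))// lerD.
Qed.

Lemma coord_le_enorm u k : `|u 0 k| <= enorm u.
Proof.
rewrite -(ler_pXn2r (n:=2)) ?nnegrE ?enorm_ge0// real_normK ?num_real//.
rewrite sqr_enorm /dotv (bigD1 k)//= -expr2 lerDl.
by apply: sumr_ge0 => i _; rewrite -expr2 sqr_ge0.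
Qed.

Lemma enorm_le_sum u : enorm u <= \sum_k `|u 0 k|.
Proof.
rewrite -(ler_pXn2r (n:=2)) ?nnegrE ?enorm_ge0 ?sumr_ge0//.
rewrite sqr_enorm expr2 mulr_suml; apply: ler_sum => k _.
rewrite -expr2 -[leLHS]real_normK ?num_real// expr2 ler_wpM2l//.
by rewrite (bigD1 k)//= lerDl sumr_ge0.
Qed.

(** * Bias and variance of clipping *)

Section clipping.
Context (l : R) (l_gt0 : 0 < l).
Implicit Types (y g : 'rV[R]_d) (p : R).

Lemma clip_id y : enorm y <= l -> clip l y = y.
Proof.
move=> yl; rewrite /clip; have [->|y0] := eqVneq y 0; first by rewrite scaler0.
have yp : 0 < enorm y.
  by rewrite lt_def enorm_ge0 andbT; apply: contra y0 => /eqP/enorm0_eq0/eqP.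
by rewrite min_l ?scale1r// ler_pdivlMr// mul1r.
Qed.

Lemma clip_big y : l <= enorm y -> clip l y = (l / enorm y) *: y.
Proof.
move=> ly; rewrite /clip min_r// ler_pdivrMr ?mul1r//; exact: lt_le_trans ly.
Qed.

Lemma enorm_clip_le y : enorm (clip l y) <= l.
Proof.
have [yl|ly] := leP (enorm y) l; first by rewrite clip_id.
have y0 : 0 < enorm y by exact: lt_trans ly.
rewrite (clip_big (ltW ly)) enormZ ger0_norm ?divfK ?gt_eqF//.
by rewrite divr_ge0// ltW.
Qed.

Lemma enorm_sub_clip y : l <= enorm y -> enorm (y - clip l y) = enorm y - l.
Proof.
move=> ly; have y0 : 0 < enorm y by exact: lt_le_trans ly.
rewrite clip_big// -[X in X - _]scale1r -scalerBl enormZ ger0_norm.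
  by rewrite mulrBl mul1r divfK ?gt_eqF.
by rewrite subr_ge0 ler_pdivrMr// mul1r.
Qed.

(* If [g] has norm at most [l / 2], clipping acts on [y] only when the noise
   [y - g] has norm at least [l / 2], and [s <= s `^ p * c `^ (1 - p)] for
   [s >= c]. *)
Lemma clip_bias y g p : 1 < p -> enorm g <= l / 2 ->
  enorm (y - clip l y) <= enorm (y - g) `^ p * (l / 2) `^ (1 - p).
Proof.
move=> p1 gl; set s := enorm (y - g).
have ys : enorm y <= s + enorm g by rewrite -[X in enorm X](subrK g) ler_enormD.
have [yl|ly] := leP (enorm y) l.
  by rewrite clip_id// subrr enorm0 mulr_ge0// powR_ge0.
rewrite (enorm_sub_clip (ltW ly)).
have l2 : 0 < l / 2 by rewrite divr_gt0.
have sl : l / 2 <= s by move: ys gl ly; lra.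
apply: (@le_trans _ _ s); first by move: ys gl; lra.
have s0 : 0 < s by exact: lt_le_trans sl.
have p0 : 0 < p by exact: lt_trans p1.
rewrite -(mulr_powRB1 (ltW s0) p0) -mulrA -[leLHS]mulr1 ler_wpM2l ?(ltW s0)//
  -[1 - p]opprB powRN ler_pdivlMr ?powR_gt0// mul1r.
by apply: ge0_ler_powR; rewrite ?nnegrE ?subr_ge0 ?(ltW p1) ?(ltW s0) ?(ltW l2).
Qed.

(** The error [e] is at most [2 * l], and also at most [2 * s], where [s] is the size of the noise;
    interpolating, e^2 = e^p * e^(2-p) <= (2 s)^p * (2 l)^(2-p). *)
Lemma clip_variance y g p : 1 < p -> p <= 2 -> enorm g <= l / 2 ->
  enorm (g - clip l y) ^+ 2 <= 4 * (enorm (y - g) `^ p * l `^ (2 - p)).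
Proof.
move=> p1 p2 gl; set s := enorm (y - g); set e := enorm (g - _).
have s0 : 0 <= s by exact: enorm_ge0.
have e0 : 0 <= e by exact: enorm_ge0.
have ys : enorm y <= s + enorm g by rewrite -[X in enorm X](subrK g) ler_enormD.
have el : e <= 2 * l.
  by rewrite (le_trans (ler_enormB _ _))//; have := enorm_clip_le y; move: gl l_gt0; lra.
have es : e <= 2 * s.
  have : e <= s + enorm (y - clip l y).
    by rewrite /s enormBC /e -(subrKA y) ler_enormD.
  have [yl|ly] := leP (enorm y) l.
    by rewrite clip_id// subrr enorm0; move: s0; lra.
  by rewrite (enorm_sub_clip (ltW ly)); move: ys gl l_gt0; lra.
have -> : e ^+ 2 = e `^ p * e `^ (2 - p).
  by rewrite -powR_mulrn// -powRD addrC subrK// pnatr_eq0.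
have -> : 4 = 2 `^ p * 2 `^ (2 - p) :> R.
  rewrite -powRD ?pnatr_eq0 ?implybT// addrC subrK powR_mulrn// -natrX //.
rewrite mulrACA -!powRM ?(ltW l_gt0)//.
have p0 : 0 <= p by exact: ltW (lt_trans ltr01 p1).
have q0 : 0 <= 2 - p by rewrite subr_ge0.
by apply: ler_pM; rewrite ?powR_ge0//; apply: ge0_ler_powR; rewrite ?nnegrE// mulr_ge0// ltW.
Qed.

End clipping.

(** * First-order inequality for convex functions *)

Lemma derive_grad (h : 'rV[R]_d -> R) z v : differentiable h z ->
  'D_v h z = dotv (grad h z) v.
Proof.
move=> hz; rewrite deriveE// {1}(row_sum_delta v) linear_sum; apply: eq_bigr => k _.
by rewrite linearZ /= mxE -deriveE// mulrC.
Qed.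

(** The derivative in the direction [v - z] is the right limit of difference quotients, each of
    which convexity bounds by [h v - h z]. *)
Lemma convex_grad (h : 'rV[R]_d -> R) z v : differentiable h z ->
  convex_function [set: convex_lmodType 'rV[R]_d] h ->
  h z - h v <= dotv (grad h z) (z - v).
Proof.
move=> hz hc; rewrite -[z - v]opprB dotvC dotvNl dotvC -derive_grad//.
rewrite lerNr opprB.
have dh : derivable h z (v - z) by exact: diff_derivable.
have dhr : t^-1 *: (h (t *: (v - z) + z) - h z) @[t --> 0^'+] --> 'D_(v - z) h z.
  exact: cvg_dnbhs_at_right dh.
rewrite -(cvg_lim _ dhr)//; apply: limr_le; first exact: cvgP dhr.
near=> t.
have t0 : 0 < t by near: t; exact: nbhs_right_gt.
have t1 : t <= 1 by near: t; exact: nbhs_right_le.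
have : h (t *: v + (1 - t) *: z) <= t * h v + (1 - t) * h z.
  exact: hc (Itv01 (ltW t0) t1) v z (in_setT _) (in_setT _).
rewrite [X in h X](_ : _ = t *: (v - z) + z); last first.
  by rewrite scalerBr scalerBl scale1r addrCA addrC.
by move=> H; rewrite -[leLHS]/(t^-1 * _) mulrC ler_pdivrMr//; lra.
Unshelve. all: by end_near.
Qed.

End euclidean.

(** * Measurability of vector-valued maps *)

Section measurability.
Context (disp : measure_display) (T : measurableType disp) (R : realType).
Context (d : nat).
Implicit Types X : T -> 'rV[R]_d.

Definition measurable_vec X := forall k, measurable_fun setT (fun w => X w 0 k).

(* Rounding [X] down to the grid [n.+1^-1 * Z] makes [h \o X] countably valued,
   and the rounded maps converge pointwise. *)
Lemma measurable_continuous_vec (h : 'rV[R]_d -> R) X :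
  continuous h -> measurable_vec X -> measurable_fun setT (fun w => h (X w)).
Proof.
move=> hc mX.
pose q (n : nat) (w : T) : 'rV[int]_d := \row_k Num.floor (n.+1%:R * X w 0 k).
pose Xn (n : nat) (v : 'rV[int]_d) : 'rV[R]_d := \row_k ((v 0 k)%:~R / n.+1%:R).
apply: (measurable_fun_cvg (h := fun n w => h (Xn n (q n w)))) => [n|w _].
  move=> _ A mA; rewrite setTI.
  have -> : (fun w => h (Xn n (q n w))) @^-1` A =
      \bigcup_(v in [set: 'rV[int]_d])
        (if h (Xn n v) \in A then \bigcap_(k in [set: 'I_d])
          [set w | Num.floor (n.+1%:R * X w 0 k) = v 0 k] else set0).
    apply/seteqP; split=> w /=.
      move=> Aw; exists (q n w) => //; rewrite mem_set// => k _ /=.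
      by rewrite mxE.
    move=> [v _]; case: ifPn => //; rewrite in_setE => Av wv.
    rewrite (_ : q n w = v)//; apply/rowP => k; rewrite mxE; exact: wv.
  apply: countable_bigcupT_measurable => [|v]; first exact: countableP.
  case: ifP => _; last exact: measurable0.
  apply: fin_bigcap_measurable => // k _.
  have -> : [set w | Num.floor (n.+1%:R * X w 0 k) = v 0 k] =
      [set w | (v 0 k)%:~R <= n.+1%:R * X w 0 k] `&`
      ~` [set w | (v 0 k + 1)%:~R <= n.+1%:R * X w 0 k].
    apply/seteqP; split=> w /=.
      move=> <-; have /andP[lo hi] := floor_itv (n.+1%:R * X w 0 k).
      by split=> //; apply/negP; rewrite -ltNge.
    by move=> [lo /negP hi]; apply: floor_def; rewrite lo ltNge.
  have mk : measurable_fun setT (fun w => n.+1%:R * X w 0 k).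
    by apply: measurable_funM => //; exact: mX.
  apply: measurableI; last apply: measurableC.
  - by rewrite -[X in measurable X]setTI; exact: measurable_fun_le.
  - by rewrite -[X in measurable X]setTI; exact: measurable_fun_le.
apply: (@continuous_cvg _ _ _ _ _ (fun n => Xn n (q n w)) h (X w)); first exact: hc.
apply/cvgrPdist_le => e e0; near=> n.
have ne : n.+1%:R^-1 <= e.
  near: n; have /cvgrPdist_le/(_ _ e0) := @cvg_harmonic R.
  apply: filterS => n; rewrite sub0r normrN ger0_norm//; exact: harmonic_ge0.
rewrite [leLHS]mx_normrE; apply: bigmax_le => [|[i k] _ /=]; first exact: ltW.
rewrite !mxE ord1; have /andP[lo hi] := floor_itv (n.+1%:R * X w 0 k).
have n0 : 0 < n.+1%:R :> R by [].
rewrite (le_trans _ ne)// -(ler_pM2l n0) mulfV ?gt_eqF//.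
rewrite -{1}[n.+1%:R]gtr0_norm// -normrM mulrBr mulrCA divff ?gt_eqF// mulr1.
move: hi; rewrite intrD => hi.
by rewrite ger0_norm; lra.
Unshelve. all: by end_near.
Qed.

Lemma measurable_enorm X : measurable_vec X -> measurable_fun setT (fun w => enorm (X w)).
Proof.
move=> mX; have -> : (fun w => enorm (X w)) =
    (fun w => (\sum_k X w 0 k ^+ 2) `^ 2^-1).
  apply/funext => w; rewrite powR12_sqrt//.
  by apply: sumr_ge0 => k _; exact: sqr_ge0.
apply: (measurableT_comp (measurable_powR _)).
by apply: measurable_sum => k; exact: measurable_funX.
Qed.

Lemma measurable_clip l X : 0 <= l -> measurable_vec X ->
  measurable_vec (fun w => clip l (X w)).
Proof.
move=> l0 mX k.
(* The inverse is written as a power to use the measurability of [powR]; both conventions give 0 at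
   0. *)
have -> : (fun w => clip l (X w) 0 k) =
    (fun w => Num.min 1 (l * enorm (X w) `^ (-1)) * X w 0 k).
  by apply/funext => w; rewrite mxE powR_inv1// enorm_ge0.
apply: measurable_funM => //; apply: measurable_minr => //.
apply: measurable_funM => //.
apply: (measurableT_comp (measurable_powR _)); exact: measurable_enorm.
Qed.

Lemma measurable_dotv X Y : measurable_vec X -> measurable_vec Y ->
  measurable_fun setT (fun w => dotv (X w) (Y w)).
Proof. by move=> mX mY; apply: measurable_sum => k; exact: measurable_funM. Qed.

Lemma measurable_vecB X Y : measurable_vec X -> measurable_vec Y ->
  measurable_vec (fun w => X w - Y w).
Proof.
move=> mX mY k; under eq_fun do rewrite !mxE.
by apply: measurable_funB.
Qed.

End measurability.

(** * Consensus under perturbed averaging *)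

Section consensus.
Context (R : realType) (N : nat).
Implicit Types v : 'I_N -> R.

(** The oscillation max - min; the base value 0 is harmless because the pairs (i, i) contribute
    0. *)
Definition spread v : R := \big[Num.max/0]_(q : 'I_N * 'I_N) (v q.1 - v q.2).

Lemma spread_ge0 v : 0 <= spread v.
Proof. exact: bigmax_ge_id. Qed.

Lemma le_spread v i j : v i - v j <= spread v.
Proof. by apply: (@le_bigmax _ _ _ _ (fun q => v q.1 - v q.2) (i, j)). Qed.

Lemma spread_le v c : 0 <= c -> (forall i j, v i - v j <= c) -> spread v <= c.
Proof. by move=> c0 vc; apply: bigmax_le => // -[i j] _; exact: vc. Qed.

Lemma abs_le_spread v i j : `|v i - v j| <= spread v.
Proof. by rewrite ler_norml lerNl opprB !le_spread. Qed.

Lemma connect_cross (T : finType) (e : rel T) (S : {set T}) (i j : T) :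
  connect e i j -> i \notin S -> j \in S ->
  exists a b, [/\ a \notin S, b \in S & e a b].
Proof.
move=> /connectP[s]; elim: s i => [|k s IHs] i /=.
  by move=> _ -> /negP.
move=> /andP[eik ks] js iS jS; have [kS|kS] := boolP (k \in S).
  by exists i, k.
exact: IHs ks js kS jS.
Qed.

Context (W : nat -> 'M[R]_N) (E : nat -> rel 'I_N) (theta : R) (B : nat).
Context (theta_gt0 : 0 < theta) (theta_lt1 : theta < 1).
Context (A5 : network_assumption W E theta B).

(* The agents whose state at the start of round [t + n] is influenced by the
   state of [j] at the start of round [t]. *)
Fixpoint reach (t : nat) (j : 'I_N) (n : nat) : {set 'I_N} :=
  if n is m.+1 then
    (reach t j m :|: [set i | [exists k in reach t j m, E (t + m) i k]])%SET
  else [set j]%SET.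

Lemma reach_mono t j m n : (m <= n)%N -> reach t j m \subset reach t j n.
Proof.
move=> /subnK <-; elim: (n - m)%N => //= k IHk.
by rewrite (fintype.subset_trans IHk)// finset.subsetUl.
Qed.

(** Each block of [B] rounds adds an agent unless all are reached: in the strongly connected union
    graph, a path from an agent outside to [j] has an edge entering the reached set, and its tail
    joins. The count starts at 1, hence the strict inequality. *)
Lemma reach_grow t j n : (1 <= t)%N ->
  (n < #|reach t j (n * B)|)%N || [forall i, i \in reach t j (n * B)].
Proof.
move=> t1; elim: n => [|n IHn]; first by rewrite mul0n /= cards1.
have sub : reach t j (n * B) \subset reach t j (n.+1 * B).
  by rewrite reach_mono// leq_mul2r leqnSn orbT.
have [/forallP rT|] := boolP [forall i, i \in reach t j (n * B)].
  by apply/orP; right; apply/forallP => i; apply: (fintype.subsetP sub).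
move=> nr'; move: IHn; rewrite (negbTE nr') orbF => nr.
move: nr'; rewrite negb_forall => /existsP[i ir].
have jr : j \in reach t j (n * B).
  by apply: (fintype.subsetP (reach_mono t j (leq0n _))); rewrite /= finset.in_set1.
have t1' : (1 <= t + n * B)%N by rewrite (leq_trans t1)// leq_addr.
have [_ _ /(_ _ t1' i j) ij] := A5.
have [a [b [aS bS /existsP[l eab]]]] := connect_cross ij ir jr.
apply/orP; left; apply: (leq_ltn_trans nr); apply: proper_card.
apply/properP; split=> //; exists a => //.
(* The edge from [a] to [b] is active in round [t + n * B + l], so [a] is reached one round later,
   still within the block since [l < B]. *)
apply: (fintype.subsetP (@reach_mono t j (n * B + l).+1 _ _)).
  by rewrite -addnS mulSn [leqRHS]addnC leq_add2l.
rewrite /= !finset.inE; apply/orP; right; apply/existsP; exists b.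
by rewrite addnA eab andbT (fintype.subsetP (reach_mono _ _ (leq_addr _ _)) _ bS).
Qed.

Lemma reach_all t j i : (1 <= t)%N -> i \in reach t j (N * B).
Proof.
move=> t1; have := reach_grow j N t1; rewrite ltnNge.
by rewrite (leq_trans (max_card _)) ?card_ord//= => /forallP.
Qed.

(** Meant for one coordinate of the states, the gradient step being the perturbation. *)
Definition perturbed_averaging (u : nat -> 'I_N -> R) (eps : nat -> R) :=
  forall t i, (1 <= t)%N ->
    `|u t.+1 i - \sum_j W t i j * u t j| <= eps t.

Section dynamics.
Context (u : nat -> 'I_N -> R) (eps : nat -> R).
Context (u_dyn : perturbed_averaging u eps).

Lemma averaging_lower t n m : (1 <= t)%N -> (forall j, m <= u t j) ->
  forall i, m - \sum_(t <= s < t + n) eps s <= u (t + n)%N i.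
Proof.
move=> t1 mu; elim: n => [|n IHn] i; first by rewrite addn0 big_geq// subr0.
have t1' : (1 <= t + n)%N by rewrite (leq_trans t1)// leq_addr.
rewrite addnS big_nat_recr ?leq_addr//=; have := u_dyn i t1'.
rewrite ler_norml => /andP[h _].
have [_ /(_ _ t1')[W0 W1 _] _] := A5.
set S := \sum_(t <= s < t + n) eps s in IHn *.
have : m - S <= \sum_j W (t + n)%N i j * u (t + n)%N j.
  rewrite -[leLHS]mul1r -(W1 i) mulr_suml; apply: ler_sum => k _.
  by rewrite ler_wpM2l.
by move: h; lra.
Qed.

(** The excess of agent [j] over the lower bound [m] is passed on along edges and self-loops, each
    round keeping at least the fraction [theta] of it. *)
Lemma averaging_lower_reach t n m j : (1 <= t)%N -> (forall j, m <= u t j) ->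
  forall i, i \in reach t j n ->
  m + theta ^+ n * (u t j - m) - \sum_(t <= s < t + n) eps s <= u (t + n)%N i.
Proof.
move=> t1 mu; elim: n => [|n IHn] i.
  by rewrite /= finset.in_set1 => /eqP ->; rewrite addn0 big_geq// subr0 mul1r subrKC.
move=> ir; have t1' : (1 <= t + n)%N by rewrite (leq_trans t1)// leq_addr.
have [/(_ _ t1') Wtheta /(_ _ t1')[W0 W1 _] _] := A5.
have [k kr Wk] : exists2 k, k \in reach t j n & theta <= W (t + n)%N i k.
  move: ir; rewrite /= !finset.inE => /orP[ir|].
    by exists i => //; have := Wtheta i i; rewrite /in_nbhd eqxx orbT.
  move=> /existsP[k /andP[kr Eik]]; exists k => //.
  by have := Wtheta i k; rewrite /in_nbhd Eik.
rewrite addnS big_nat_recr ?leq_addr//=; have := u_dyn i t1'.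
rewrite ler_norml => /andP[h _].
have lo := averaging_lower n t1 mu.
set S := \sum_(t <= s < t + n) eps s in IHn lo *.
set dl := theta ^+ n * (u t j - m).
have dl0 : 0 <= dl by rewrite mulr_ge0 ?exprn_ge0 ?subr_ge0// ltW.
suff : m - S + theta * dl <= \sum_j W (t + n)%N i j * u (t + n)%N j.
  by rewrite exprS -mulrA -/dl; move: h; lra.
(* Only the neighbour [k] is credited with the excess; the other agents are bounded below by
   [m - S]. *)
rewrite (bigD1 k)//=.
apply: (@le_trans _ _ (W (t + n)%N i k * (m - S + dl)
          + \sum_(l | l != k) W (t + n)%N i l * (m - S))).
  have -> : \sum_(l | l != k) W (t + n)%N i l * (m - S) =
      (1 - W (t + n)%N i k) * (m - S).
    by rewrite -mulr_suml; congr (_ * _); rewrite -(W1 i) [in RHS](bigD1 k)//= addrAC subrr add0r.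
  by have := ler_wpM2r dl0 Wk; lra.
apply: lerD; last by apply: ler_sum => l _; rewrite ler_wpM2l.
by rewrite ler_wpM2l// addrAC IHn.
Qed.

End dynamics.

Lemma perturbed_averagingN u eps :
  perturbed_averaging u eps -> perturbed_averaging (fun t i => - u t i) eps.
Proof.
move=> u_dyn t i t1; rewrite -normrN opprB; under eq_bigr do rewrite mulrN.
by rewrite sumrN opprK addrC u_dyn.
Qed.

Lemma argmin_ord (v : 'I_N -> R) (i0 : 'I_N) : exists i, forall j, v i <= v j.
Proof.
exists [arg min_(i < i0) v i]%O; case: Order.TotalTheory.arg_minP => // i _ vi j.
exact: vi.
Qed.

(** After [N * B] rounds the agent [hi] with the greatest value has influenced everyone, which lifts
    the minimum by [theta ^+ (N * B)] times the spread, while the maximum grows only by the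
    perturbations. *)
Lemma spread_contract (u : nat -> 'I_N -> R) (eps : nat -> R) t :
  perturbed_averaging u eps -> (1 <= t)%N -> (forall s, 0 <= eps s) ->
  spread (u (t + N * B)%N) <= (1 - theta ^+ (N * B)) * spread (u t)
    + 2 * \sum_(t <= s < t + N * B) eps s.
Proof.
move=> u_dyn t1 eps0; set M := (N * B)%N.
have th1 : 0 <= 1 - theta ^+ M.
  by rewrite subr_ge0 exprn_ile1// ltW.
apply: spread_le => [|i i'].
  by rewrite addr_ge0 ?mulr_ge0 ?spread_ge0 ?sumr_ge0.
have [lo lo_le] := argmin_ord (u t) i.
have [hi hi_ge] := argmin_ord (fun j => - u t j) i.
have := averaging_lower (perturbed_averagingN u_dyn) M t1 hi_ge i.
have := averaging_lower_reach u_dyn (n := M) (j := hi) t1 lo_le (i := i').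
rewrite reach_all// => /(_ isT).
have := ler_wpM2l th1 (le_spread (u t) hi lo).
by lra.
Qed.

Lemma spread_step (u : nat -> 'I_N -> R) (eps : nat -> R) t :
  perturbed_averaging u eps -> (1 <= t)%N -> (forall s, 0 <= eps s) ->
  spread (u t.+1) <= spread (u t) + 2 * eps t.
Proof.
move=> u_dyn t1 eps0; apply: spread_le => [|i i'].
  by rewrite addr_ge0 ?mulr_ge0 ?spread_ge0.
have [lo lo_le] := argmin_ord (u t) i.
have [hi hi_ge] := argmin_ord (fun j => - u t j) i.
have := averaging_lower (perturbed_averagingN u_dyn) 1 t1 hi_ge i.
have := averaging_lower u_dyn 1 t1 lo_le i'.
rewrite addn1 big_nat1.
by have := le_spread (u t) hi lo; lra.
Qed.

(** Instead of unrolling the contraction into a geometric series, it is summed over all rounds, so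
    that the sum [S] appears on both sides. [A] bounds the first [M] rounds, which no contraction
    covers. [C] is independent of [u], hence later of the outcome. *)
Lemma sum_spread (c : R) (eps : nat -> R) :
  (forall s, 0 <= eps s) ->
  (forall s t, (1 <= s)%N -> (s <= t)%N -> eps t <= eps s) ->
  exists C, forall u, perturbed_averaging u eps -> spread (u 1%N) <= c ->
    forall T, \sum_(1 <= t < T.+1) spread (u t)
      <= C * (1 + \sum_(1 <= t < T.+1) eps t).
Proof.
move=> eps0 eps_anti; set M := (N * B)%N; set r := theta ^+ M.
have r0 : 0 < r by rewrite exprn_gt0.
pose A := \sum_(1 <= t < M.+1) (c + 2 * \sum_(1 <= s < t) eps s).
exists ((`|A| + 2 * M%:R) / r) => u u_dyn uc T.
have head t : (1 <= t)%N ->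
    spread (u t) <= c + 2 * \sum_(1 <= s < t) eps s.
  case: t => // t _; elim: t => [|t IHt]; first by rewrite big_geq// mulr0 addr0.
  rewrite big_nat_recr//= mulrDr addrA.
  by rewrite (le_trans (spread_step u_dyn _ _))// lerD2r.
have hA : \sum_(1 <= t < M.+1) spread (u t) <= A.
  by apply: ler_sum_nat => t /andP[t1 _]; exact: head.
set S := \sum_(1 <= t < T.+1) spread (u t); set e := \sum_(1 <= t < T.+1) eps t.
have tail : \sum_(1 <= t < T.+1) spread (u (t + M)%N) <=
    (1 - r) * S + 2 * M%:R * e.
  rewrite /S /e !mulr_sumr -big_split/=; apply: ler_sum_nat => t /andP[t1 _].
  rewrite (le_trans (spread_contract u_dyn _ _))// lerD2l -mulrA ler_wpM2l//.
  have -> : M%:R * eps t = \sum_(t <= s < t + M) eps t.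
    by rewrite sumr_const_nat addKn mulr_natl.
  by apply: ler_sum_nat => s /andP[ts _]; exact: eps_anti.
(* Moving [(1 - r) * S] to the left leaves [r * S], whence the division by [r] in the constant. *)
have : S <= A + ((1 - r) * S + 2 * M%:R * e).
  rewrite (le_trans _ (lerD hA tail))//.
  have <- : \sum_(1 + M <= t < T.+1 + M) spread (u t) =
      \sum_(1 <= t < T.+1) spread (u (t + M)%N).
    by rewrite big_addn addnK.
  rewrite -big_cat_nat//=; last by rewrite addSn ltnS leq_addl.
  rewrite addnC.
  rewrite (@big_cat_nat _ _ _ T.+1 1 (M + T.+1))//= ?leq_addl//.
  by rewrite lerDl sumr_ge0// => t _; exact: spread_ge0.
have e0 : 0 <= e by rewrite sumr_ge0.
have := ler_norm A.
have M0 : 0 <= M%:R :> R by [].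
have := mulr_ge0 (normr_ge0 A) e0.
have Me := mulr_ge0 M0 e0.
by move=> h1 h2 h3; rewrite [leRHS]mulrAC ler_pdivlMr//; lra.
Qed.

End consensus.

(** * Expectations, and conditional expectations tested against bounded weights *)

Section expectation.
Context (disp : measure_display) (Omega : measurableType disp) (R : realType).
Variable P : probability Omega R.
Implicit Types (X Y U V : Omega -> R) (c : R).

Definition intg X := P.-integrable setT (EFin \o X).
Local Notation "'Ex' X" := (\int[P]_w X w) (at level 10).

Lemma intg_meas X : intg X -> measurable_fun setT X.
Proof. by move=> /measurable_int/measurable_EFinP. Qed.

Lemma intgD X Y : intg X -> intg Y -> intg (fun w => X w + Y w).
Proof. by move=> iX iY; exact: (integrableD _ iX iY). Qed.

Lemma intgZ c X : intg X -> intg (fun w => c * X w).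
Proof. by move=> iX; exact: (integrableZl _ c iX). Qed.

Lemma intgB X Y : intg X -> intg Y -> intg (fun w => X w - Y w).
Proof. by move=> iX iY; exact: (integrableB _ iX iY). Qed.

Lemma intg_sum (I : Type) (s : seq I) (F : I -> Omega -> R) :
  (forall i, intg (F i)) -> intg (fun w => \sum_(i <- s) F i w).
Proof.
move=> iF; elim: s => [|i s IHs].
  under [X in intg X]funext do rewrite big_nil.
  exact: finite_measure_integrable_cst.
under [X in intg X]funext do rewrite big_cons.
exact: intgD.
Qed.

Lemma intg_bounded X c : measurable_fun setT X -> (forall w, `|X w| <= c) ->
  intg X.
Proof.
move=> mX Xc; apply: measurable_bounded_integrable => //.
  exact: le_lt_trans (probability_le1 P measurableT) (ltry _).
by exists c; split=> [|M cM w _]; [exact: num_real|exact: le_trans (ltW cM)].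
Qed.

Lemma intg_boundedM U X c : measurable_fun setT U -> (forall w, `|U w| <= c) ->
  intg X -> intg (fun w => U w * X w).
Proof.
move=> mU Uc iX; apply: (integrableMr _ mU _ iX) => //.
by exists c; split=> [|M cM w _]; [exact: num_real|exact: le_trans (ltW cM)].
Qed.

Lemma ex_le X Y : intg X -> intg Y -> {ae P, forall w, X w <= Y w} ->
  Ex X <= Ex Y.
Proof.
move=> iX iY [A [mA PA XY]].
rewrite /Rintegral (negligible_integral mA _ iX PA)//.
rewrite (negligible_integral mA _ iY PA)//.
have mD : measurable (setT `\` A) by exact: measurableD.
apply: le_Rintegral; [by []|exact: integrableS iX|exact: integrableS iY|].
move=> w [_ Aw]; apply: contrapT => /negP; rewrite -ltNge => YX.
by apply: Aw; apply: XY; rewrite /= leNgt YX.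
Qed.

Lemma ex_cst c : Ex (fun=> c) = c.
Proof. by rewrite Rintegral_cst//; have /= -> := probability_setT P; rewrite mulr1. Qed.

Lemma ex_sum (I : Type) (s : seq I) (F : I -> Omega -> R) :
  (forall i, intg (F i)) ->
  Ex (fun w => \sum_(i <- s) F i w) = \sum_(i <- s) Ex (F i).
Proof.
move=> iF; elim: s => [|i s IHs].
  under eq_Rintegral do rewrite big_nil.
  by rewrite ex_cst big_nil.
under eq_Rintegral do rewrite big_cons.
by rewrite big_cons RintegralD// ?IHs//; [exact: iF|exact: intg_sum].
Qed.

Lemma ex_markov X c : intg X -> (forall w, 0 <= X w) -> 0 < c ->
  (P [set w | (c <= X w)%R] <= (Ex X / c)%:E)%E.
Proof.
move=> iX X0 c0; have mX := intg_meas iX.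
have mS : measurable [set w | c <= X w].
  rewrite -[X in measurable X]setTI.
  exact: measurable_fun_le.
have := le_integral_abse P measurableT (proj2 (measurable_EFinP _ _) mX) c0.
have abs_id w : (`|(EFin \o X) w| = (X w)%:E)%E by rewrite /= ger0_norm.
under eq_integral do rewrite abs_id.
have -> : (\int[P]_w (X w)%:E = (Ex X)%:E)%E by rewrite fineK//; exact: integrable_fin_num iX.
have -> : setT `&` [set x | (c%:E <= `|(EFin \o X) x|)%E] = [set w | c <= X w].
  by rewrite setTI; apply/funext => w /=; rewrite ger0_norm// lee_fin.
have div_c (y : \bar R) e : (0 <= y)%E -> (y <= 1)%E ->
    (c%:E * y <= e%:E)%E -> (y <= (e / c)%:E)%E.
  by case: y => [r| |]//= _ _; rewrite -EFinM !lee_fin ler_pdivlMr// mulrC.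
by apply: div_c => //; exact: probability_le1.
Qed.

Lemma probability_ge_cover (A D Q : set Omega) c :
  measurable A -> measurable D -> measurable Q ->
  P A = 0 -> (P D <= c%:E)%E -> ~` Q `<=` A `|` D -> ((1 - c)%R%:E <= P Q)%E.
Proof.
move=> mA mD mQ PA PD QAD.
have mQC : measurable (~` Q) by exact: measurableC.
have PQC : (P (~` Q) <= c%:E)%E.
  apply: le_trans PD; apply: (@le_trans _ _ (P (A `|` D))).
    by apply: le_measure; rewrite ?inE//; exact: measurableU.
  apply: (le_trans (measureU2 P mA mD)).
  by have /= -> := PA; rewrite add0e.
have sum1 : (P Q + P (~` Q) = 1)%E.
  have := probability_setC P mQ => /= ->.
  by rewrite addeC subeK// fin_num_measure.
by rewrite EFinB leeBlDr// -[leLHS]sum1 leeD2l.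
Qed.

(* The integer part of [v], capped at [m], as a sum of indicators. *)
Definition stair (m : nat) (v : R) : R := \sum_(k < m) (k.+1%:R <= v)%R%:R.

Lemma stair_approx m v : 0 <= v -> v < m%:R -> 0 <= v - stair m v <= 1.
Proof.
(* The induction also needs the saturated case, where all [m] indicators equal 1. *)
suff h : (m%:R <= v -> stair m v = m%:R) /\
    (0 <= v -> v < m%:R -> 0 <= v - stair m v <= 1).
  by move=> v0 vm; exact: h.2.
elim: m => [|m [IH1 IH2]].
  by split=> [_|v0]; [rewrite /stair big_ord0|rewrite ltNge v0].
rewrite /stair !big_ord_recr/= -/(stair m v); split=> [mv|v0 mv].
  have mv' : m%:R <= v by rewrite (le_trans _ mv)// ler_nat.
  by rewrite mv IH1// natr1.
rewrite [m.+1%:R <= v]leNgt mv/= addr0; have [mv'|vm] := leP m%:R v; last exact: IH2.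
by rewrite IH1// subr_ge0 mv' lerBlDr addrC natr1 ltW.
Qed.

Section sub_sigma_field.
Variable G : set (set Omega).
Hypothesis G_meas : G `<=` measurable.
Let FT := g_sigma_algebraType G.

Lemma g_sigma_sub : <<s G >> `<=` (measurable : set (set Omega)).
Proof. by apply: smallest_sub => //; exact: sigma_algebra_measurable. Qed.

Lemma sub_measurable_fun U :
  measurable_fun (setT : set FT) (U : FT -> R) -> measurable_fun setT U.
Proof.
by move=> mU _ A mA; apply: g_sigma_sub; have := mU measurableT A mA.
Qed.

Lemma intg_abs X : intg X -> intg (fun w => `|X w|).
Proof. by move=> iX; exact: (integrable_abse iX). Qed.

(** [V] is within [n%:R^-1] of a combination of indicators of its own level sets, which belong to
    the sub-sigma-field. The bound on [m] keeps the cap of [stair] out of reach. *)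
Lemma stair_expectation V c (n m : nat) X :
  measurable_fun (setT : set FT) (V : FT -> R) ->
  (forall w, 0 <= V w <= c) -> (0 < n)%N -> n%:R * c < m%:R -> intg X ->
  `|Ex (fun w => V w * X w) - n%:R^-1 * \sum_(k < m)
     \int[P]_(w in [set w | (k.+1%:R <= n%:R * V w)%R]) X w|
  <= n%:R^-1 * Ex (fun w => `|X w|).
Proof.
move=> mVF Vc n0 ncm iX; have mV := sub_measurable_fun mVF.
have n0' : 0 < n%:R :> R by rewrite ltr0n.
pose S w := stair m (n%:R * V w).
have mI k : measurable [set w | (k%:R <= n%:R * V w)%R].
  rewrite -[X in measurable X]setTI; apply: measurable_fun_le => //.
  exact: measurable_funM.
have Sb w : `|V w - n%:R^-1 * S w| <= n%:R^-1.
  have /andP[V0 Vc'] := Vc w.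
  have nV0 : 0 <= n%:R * V w by rewrite mulr_ge0.
  have nVm : n%:R * V w < m%:R by rewrite (le_lt_trans _ ncm)// ler_wpM2l.
  have /andP[S0 S1] := stair_approx nV0 nVm.
  rewrite -(ler_pM2l n0') -{1}[n%:R]gtr0_norm// -normrM mulrBr.
  by rewrite mulVKf ?gt_eqF// mulfV ?gt_eqF// ger0_norm.
have iVX : intg (fun w => V w * X w).
  apply: intg_boundedM mV _ iX => w; have /andP[V0] := Vc w.
  rewrite ger0_norm//; exact.
have [-> iS] : n%:R^-1 * \sum_(k < m)
     \int[P]_(w in [set w | (k.+1%:R <= n%:R * V w)%R]) X w =
     Ex (fun w => n%:R^-1 * (S w * X w)) /\ intg (fun w => S w * X w).
  have iIX (k : 'I_m) : intg (fun w => (k.+1%:R <= n%:R * V w)%R%:R * X w).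
    apply: (intg_boundedM (c := 1)) _ _ iX => [|w].
      rewrite (_ : (fun w => _) = \1_[set w | (k.+1%:R <= n%:R * V w)%R]).
        by apply: measurable_indic; exact: mI.
      by apply/funext => w; rewrite indicE mem_setE.
    by case: (k.+1%:R <= _); rewrite ?normr1 ?normr0.
  have SE w : S w * X w = \sum_(k < m) (k.+1%:R <= n%:R * V w)%R%:R * X w.
    by rewrite /S /stair mulr_suml.
  have iS : intg (fun w => S w * X w).
    by under [X in intg X]funext do rewrite SE; exact: intg_sum.
  split=> //; rewrite RintegralZl//; congr (_ * _).
  under [RHS]eq_Rintegral do rewrite SE.
  rewrite ex_sum//; apply: eq_bigr => k _; rewrite Rintegral_mkcond.
  apply: eq_Rintegral => w _; rewrite patchE.
  case: ifPn; first by rewrite in_setE /= => ->; rewrite mul1r.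
  by rewrite notin_setE /= => /negP/negbTE ->; rewrite mul0r.
rewrite -RintegralB//; last exact: intgZ.
rewrite (le_trans (le_normr_Rintegral _ _))//.
  by apply: intgB => //; exact: intgZ.
rewrite -RintegralZl//; last exact: intg_abs.
apply: le_Rintegral => //.
- by apply: intg_abs; apply: intgB => //; exact: intgZ.
- by apply: intgZ; exact: intg_abs.
move=> w _; rewrite mulrA -mulrBl normrM ler_wpM2r//.
Qed.

(** [X] and [Y] have equal integrals over the level sets of [V], so their staircase sums coincide
    and the two expectations differ by at most [K / n] for every positive [n]. *)
Lemma cond_exp_mul_ge0 V c X Y : is_cond_exp P <<s G >> X Y ->
  measurable_fun (setT : set FT) (V : FT -> R) ->
  (forall w, 0 <= V w <= c) ->
  Ex (fun w => V w * X w) = Ex (fun w => V w * Y w).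
Proof.
move=> [iX iY _ XY] mV Vc; apply/eqP; rewrite -subr_eq0 -normr_le0.
set K := Ex (fun w => `|X w|) + Ex (fun w => `|Y w|).
have approx n : (0 < n)%N ->
    n%:R * `|Ex (fun w => V w * X w) - Ex (fun w => V w * Y w)| <= K.
  move=> n0; have n0' : 0 < n%:R :> R by rewrite ltr0n.
  pose m := Num.bound `|n%:R * c|.
  have ncm : n%:R * c < m%:R.
    by rewrite (le_lt_trans (ler_norm _))// archi_boundP.
  have hX := stair_expectation mV Vc n0 ncm iX.
  have hY := stair_expectation mV Vc n0 ncm iY.
  have e : \sum_(k < m) \int[P]_(w in [set w | (k.+1%:R <= n%:R * V w)%R]) X w
      = \sum_(k < m) \int[P]_(w in [set w | (k.+1%:R <= n%:R * V w)%R]) Y w.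
    apply: eq_bigr => k _; congr fine; apply: XY.
    have : measurable ([set w | k.+1%:R <= n%:R * V w] : set FT).
      rewrite -[X in measurable X]setTI; apply: measurable_fun_le => //.
      exact: measurable_funM.
    by [].
  rewrite e in hX; rewrite -ler_pdivlMl// /K mulrDr.
  rewrite distrC in hY.
  exact: le_trans (ler_distD _ _ _) (lerD hX hY).
rewrite leNgt; apply/negP => d0.
have := archi_boundP (normr_ge0 (K / `|Ex (fun w => V w * X w) - Ex (fun w => V w * Y w)|)).
set n := Num.bound _ => /(le_lt_trans (ler_norm _)).
rewrite ltr_pdivrMr//.
have [n0|n0] := posnP n.
  by rewrite n0 mul0r => K0; have := approx 1%N isT; rewrite mul1r; lra.
by have := approx n n0; lra.
Qed.

(** Adding [c] makes the weight nonnegative; the correction is [c] times the mean, equal for [X] and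
    [Y] by the weight 1. *)
Lemma cond_exp_mul U c X Y : is_cond_exp P <<s G >> X Y ->
  measurable_fun (setT : set FT) (U : FT -> R) -> (forall w, `|U w| <= c) ->
  Ex (fun w => U w * X w) = Ex (fun w => U w * Y w).
Proof.
move=> cXY mU Uc; have [iX iY _ _] := cXY.
have mV : measurable_fun (setT : set FT) (fun w : FT => U w + c).
  by apply: measurable_funD => //; exact: measurable_cst.
have Vc w : 0 <= U w + c <= c + c.
  by have := Uc w; rewrite ler_norml lerD2r => /andP[]; lra.
have shift Z : intg Z -> Ex (fun w => U w * Z w) =
    Ex (fun w => (U w + c) * Z w) - c * Ex Z.
  move=> iZ; rewrite -RintegralZl// -RintegralB//; last exact: intgZ.
    by apply: eq_Rintegral => w _; rewrite mulrDl addrK.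
  apply: (intg_boundedM (c := c + c)) iZ; first exact: sub_measurable_fun.
  by move=> w; rewrite ger0_norm; have /andP[] := Vc w.
rewrite !shift// (cond_exp_mul_ge0 cXY mV Vc).
have : Ex (fun w => cst 1 w * X w) = Ex (fun w => cst 1 w * Y w).
  by apply: (cond_exp_mul_ge0 (c := 1) cXY) => //= w; rewrite ler01 lexx.
have one Z : Ex (fun w => cst 1 w * Z w) = Ex Z.
  by apply: eq_Rintegral => w _; rewrite mul1r.
by rewrite !one => ->.
Qed.

End sub_sigma_field.
End expectation.

(** * Scalar inequalities *)

Section scalar.
Context (R : realType).

(** From exp(-z) >= 1 - z one gets exp(z) <= 1 / (1 - z), and (1 + z + 2 z^2) (1 - z) = 1 + z^2 (1 -
    2 z). Very negative [z] are allowed. *)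
Lemma expR_le_quadratic (z : R) : z <= 2^-1 -> expR z <= 1 + z + 2 * z ^+ 2.
Proof.
move=> z2; have z1 : 0 < 1 - z by lra.
have : expR z * (1 - z) <= 1.
  apply: le_trans (_ : expR z * expR (- z) <= 1); last by rewrite expRxMexpNx_1.
  by rewrite ler_wpM2l ?expR_ge0// expR_ge1Dx.
rewrite -ler_pdivlMr// => /le_trans; apply.
rewrite ler_pdivrMr//; have := sqr_ge0 z => zz.
have : 0 <= z ^+ 2 * (1 - 2 * z) by rewrite mulr_ge0//; lra.
by lra.
Qed.

Lemma sum_rsqrt_le (T : nat) :
  \sum_(1 <= t < T.+1) t%:R `^ (- 2^-1) <= 2 * T%:R `^ 2^-1 :> R.
Proof.
elim: T => [|T IHT]; first by rewrite big_geq// mulr_ge0 ?powR_ge0.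
rewrite big_nat_recr//= (le_trans (lerD IHT (lexx _)))//.
rewrite powRN !powR12_sqrt//; set s := Num.sqrt T%:R; set r := Num.sqrt _.
have s2 : s ^+ 2 = T%:R by rewrite sqr_sqrtr.
have r2 : r ^+ 2 = T%:R + 1 by rewrite sqr_sqrtr// natr1.
have r0 : 0 < r by rewrite sqrtr_gt0.
have := sqr_ge0 (r - s); rewrite sqrrB => rs.
rewrite -lerBrDl -(ler_pM2r r0) mulVf ?gt_eqF//.
by move: rs s2 r2; lra.
Qed.

(** Abel summation with increasing weights. In use, [al t] and [be t] are the potentials of the
    average state before and after round [t], both for the comparator of round [t]; [ga t.+1] pays
    for the change of comparator between [be t] and [al t.+1]. *)
Lemma weighted_telescope (h al be ga : nat -> R) (Q : R) (n : nat) :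
  (forall t, (1 <= t)%N -> 0 <= h t) ->
  (forall t, (1 <= t)%N -> h t <= h t.+1) ->
  (forall t, 0 <= ga t) ->
  (forall t, (1 <= t <= n.+1)%N -> `|be t| <= Q) -> al 1%N <= Q ->
  (forall t, (1 <= t <= n)%N -> al t.+1 <= be t + ga t.+1) ->
  \sum_(1 <= t < n.+2) h t * (al t - be t)
    <= h n.+1 * (2 * Q + \sum_(2 <= t < n.+2) ga t).
Proof.
(* Keeping [- be n.+1] makes the induction work: [Q - be n.+1] is nonnegative, so its weight may be
   raised to [h n.+2]. *)
move=> h0 h_incr ga0; suff H : (forall t, (1 <= t <= n.+1)%N -> `|be t| <= Q) ->
    al 1%N <= Q -> (forall t, (1 <= t <= n)%N -> al t.+1 <= be t + ga t.+1) ->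
    \sum_(1 <= t < n.+2) h t * (al t - be t)
    <= h n.+1 * (Q - be n.+1 + \sum_(2 <= t < n.+2) ga t).
  move=> beQ al1 alS; rewrite (le_trans (H beQ al1 alS))// ler_wpM2l ?h0//.
  by rewrite lerD2r; have := beQ n.+1; rewrite ltnSn => /(_ isT); rewrite ler_norml; lra.
elim: n => [|n IHn] beQ al1 alS.
  by rewrite big_nat1 big_geq// addr0 ler_wpM2l ?h0// lerD2r.
have beQ' t : (1 <= t <= n.+1)%N -> `|be t| <= Q.
  by move=> /andP[t1 tn]; rewrite beQ// t1 leqW.
have alS' t : (1 <= t <= n)%N -> al t.+1 <= be t + ga t.+1.
  by move=> /andP[t1 tn]; rewrite alS// t1 leqW.
have := IHn beQ' al1 alS'.
rewrite (big_nat_recr n.+2)//= (big_nat_recr n.+2 2)//=.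
set S := \sum_(1 <= t < n.+2) _; set D := \sum_(2 <= t < n.+2) _.
have D0 : 0 <= D by rewrite sumr_ge0.
have beQn : be n.+1 <= Q by apply: le_trans (ler_norm _) (beQ' _ _); rewrite ltnSn.
have hh : h n.+1 * (Q - be n.+1 + D) <= h n.+2 * (Q - be n.+1 + D).
  by rewrite ler_wpM2r ?h_incr// addr_ge0// subr_ge0.
have := alS n.+1; rewrite ltnSn => /(_ isT) al2.
have : h n.+2 * al n.+2 <= h n.+2 * (be n.+1 + ga n.+2) by rewrite ler_wpM2l ?h0.
by lra.
Qed.

End scalar.

(** * Sums of clipping levels and step sizes *)

Section schedule.
Context (R : realType) (p Bg a b : R).
Context (p_gt1 : 1 < p) (p_le2 : p <= 2) (Bg_gt0 : 0 < Bg).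
Context (a_gt0 : 0 < a) (b_ge0 : 0 <= b).

Definition clip_level (t : nat) : R := 2 * Bg * t%:R `^ (1 / (2 * p)).
Definition step_size (t : nat) : R := 1 / (a * t%:R + b) `^ ((p + 1) / (2 * p)).
Local Notation lam := clip_level.
Local Notation eta := step_size.
Local Notation kap := ((1 + p) / (2 * p)).
Local Notation alp := (1 / (2 * p)).

Let p_gt0 : 0 < p. Proof. exact: lt_trans p_gt1. Qed.

Lemma kapE : kap = alp + 2^-1.
Proof. by field; rewrite gt_eqF. Qed.

Lemma alp_gt0 : 0 < alp.
Proof. by rewrite divr_gt0// mulr_gt0. Qed.

Lemma powR_incr (s : R) (t u : nat) : 0 <= s -> (t <= u)%N ->
  t%:R `^ s <= u%:R `^ s :> R.
Proof.
by move=> s0 tu; apply: ge0_ler_powR; rewrite ?nnegrE// ler_nat.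
Qed.

Lemma powR_nat_ge1 (s : R) (t : nat) : 0 <= s -> (1 <= t)%N -> 1 <= t%:R `^ s :> R.
Proof. by move=> s0 t1; have := powR_incr s0 t1; rewrite mulr1n powR1. Qed.

Lemma powR_natD (s r : R) (t : nat) : (1 <= t)%N ->
  t%:R `^ (s + r) = t%:R `^ s * t%:R `^ r :> R.
Proof. by move=> t1; rewrite powRD// pnatr_eq0 -lt0n t1 implybT. Qed.

Lemma clip_level_gt0 t : (1 <= t)%N -> 0 < lam t.
Proof. by move=> t1; rewrite !mulr_gt0// powR_gt0// ltr0n. Qed.

Lemma clip_level_ge0 t : 0 <= lam t.
Proof. by rewrite !mulr_ge0 ?powR_ge0// ltW. Qed.

Lemma clip_level_incr t u : (t <= u)%N -> lam t <= lam u.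
Proof.
move=> tu; rewrite ler_wpM2l ?mulr_ge0 ?(ltW Bg_gt0)//.
by apply: powR_incr => //; exact: ltW alp_gt0.
Qed.

Lemma clip_level_ge t : (1 <= t)%N -> Bg <= lam t / 2.
Proof.
move=> t1; have := powR_nat_ge1 (ltW alp_gt0) t1.
by rewrite -(ler_pM2l Bg_gt0) /lam; lra.
Qed.

Lemma clip_level_sqrt T : (1 <= T)%N -> lam T * T%:R `^ 2^-1 = 2 * Bg * T%:R `^ kap.
Proof. by move=> T1; rewrite kapE powR_natD// mulrA. Qed.

Let base_gt0 t : (1 <= t)%N -> 0 < a * t%:R + b.
Proof. by move=> t1; rewrite ltr_wpDr// mulr_gt0// ltr0n. Qed.

Lemma kap_gt0 : 0 < (p + 1) / (2 * p).
Proof. by rewrite divr_gt0// ?mulr_gt0// addr_gt0. Qed.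

Lemma step_size_gt0 t : (1 <= t)%N -> 0 < eta t.
Proof. by move=> t1; rewrite divr_gt0// powR_gt0// base_gt0. Qed.

Lemma inv_step_size_incr t : (1 <= t)%N -> (eta t)^-1 <= (eta t.+1)^-1.
Proof.
move=> t1; rewrite /eta !mul1r !invrK; apply: ge0_ler_powR.
- exact: ltW kap_gt0.
- by rewrite nnegrE ltW// base_gt0.
- by rewrite nnegrE ltW// base_gt0.
- by rewrite lerD2r ler_pM2l// ler_nat.
Qed.

Lemma inv_step_size_le T : (1 <= T)%N ->
  (eta T)^-1 <= (a + b) `^ ((p + 1) / (2 * p)) * T%:R `^ kap.
Proof.
move=> T1; rewrite /eta mul1r invrK [1 + p]addrC -powRM ?addr_ge0 ?(ltW a_gt0)//.
apply: ge0_ler_powR.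
- exact: ltW kap_gt0.
- by rewrite nnegrE ltW// base_gt0.
- by rewrite nnegrE mulr_ge0// addr_ge0// ltW.
- by rewrite mulrDl lerD2l ler_peMr// ler1n.
Qed.

(** The value of [eta t * lam t] for [b = 0]. Unlike the product itself, which may first increase
    when [b] is large, it is non-increasing, as [sum_spread] requires. *)
Definition drift_bound (t : nat) : R :=
  2 * Bg / a `^ ((p + 1) / (2 * p)) * t%:R `^ (- 2^-1).

Lemma drift_le t : (1 <= t)%N -> eta t * lam t <= drift_bound t.
Proof.
move=> t1; have t0 : 0 < t%:R :> R by rewrite ltr0n.
have -> : drift_bound t = 1 / (a * t%:R) `^ ((p + 1) / (2 * p)) * lam t.
  rewrite /drift_bound /lam powRM ?(ltW a_gt0)// [p + 1]addrC.
  have -> : t%:R `^ (- 2^-1) = t%:R `^ alp / t%:R `^ kap :> R.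
    rewrite -powRN -powR_natD// kapE; congr (_ `^ _); ring.
  by field; rewrite !gt_eqF ?powR_gt0.
rewrite ler_wpM2r ?clip_level_ge0// /eta !mul1r lef_pV2 ?posrE ?powR_gt0 ?base_gt0 ?mulr_gt0//.
apply: ge0_ler_powR.
- exact: ltW kap_gt0.
- by rewrite nnegrE ltW// mulr_gt0.
- by rewrite nnegrE ltW// base_gt0.
- by rewrite lerDl.
Qed.

Lemma drift_bound_ge0 t : 0 <= drift_bound t.
Proof. by rewrite !mulr_ge0 ?invr_ge0 ?powR_ge0// ltW. Qed.

Lemma drift_bound_anti s t : (1 <= s)%N -> (s <= t)%N -> drift_bound t <= drift_bound s.
Proof.
move=> s1 st; rewrite ler_wpM2l ?mulr_ge0 ?invr_ge0 ?powR_ge0 ?(ltW Bg_gt0)//.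
have t1 := leq_trans s1 st.
rewrite !powRN lef_pV2 ?posrE ?powR_gt0 ?ltr0n//.
by apply: powR_incr => //; rewrite invr_ge0.
Qed.

Lemma sum_drift T : \sum_(1 <= t < T.+1) drift_bound t <=
  4 * Bg / a `^ ((p + 1) / (2 * p)) * T%:R `^ 2^-1.
Proof.
rewrite -mulr_sumr (_ : 4 * Bg / _ * _ =
  2 * Bg / a `^ ((p + 1) / (2 * p)) * (2 * T%:R `^ 2^-1)); last by ring.
by rewrite ler_wpM2l ?sum_rsqrt_le// !mulr_ge0 ?invr_ge0 ?powR_ge0// ltW.
Qed.

(** Since alp * (1 - p) = alp - 1/2, each term is at most a constant times T^alp * t^(-1/2). *)
Lemma sum_bias T : (1 <= T)%N ->
  \sum_(1 <= t < T.+1) (lam t / 2) `^ (1 - p) <= 2 * Bg `^ (1 - p) * T%:R `^ kap.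
Proof.
move=> T1.
have -> : 2 * Bg `^ (1 - p) * T%:R `^ kap =
    Bg `^ (1 - p) * T%:R `^ alp * (2 * T%:R `^ 2^-1).
  by rewrite kapE powR_natD//; ring.
apply: (@le_trans _ _ (Bg `^ (1 - p) * T%:R `^ alp *
    \sum_(1 <= t < T.+1) t%:R `^ (- 2^-1))); last first.
  by rewrite ler_wpM2l ?sum_rsqrt_le// mulr_ge0 ?powR_ge0.
rewrite mulr_sumr; apply: ler_sum_nat => t /andP[t1 tT].
have -> : lam t / 2 = Bg * t%:R `^ alp by rewrite /lam; field.
rewrite powRM ?powR_ge0 ?(ltW Bg_gt0)// -mulrA ler_wpM2l ?powR_ge0//.
rewrite -powRrM (_ : 1 / (2 * p) * (1 - p) = alp - 2^-1); last first.
  by field; rewrite gt_eqF.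
rewrite powR_natD// ler_wpM2r ?powR_ge0//.
by apply: powR_incr => //; exact: ltW alp_gt0.
Qed.

(** All levels are replaced by the last one, and 1 + alp * (2 - p) = kap + alp. *)
Lemma sum_variance T : (1 <= T)%N ->
  \sum_(1 <= t < T.+1) lam t `^ (2 - p) <=
    (2 * Bg) `^ (2 - p) * (T%:R `^ kap * T%:R `^ alp).
Proof.
move=> T1.
apply: (@le_trans _ _ (\sum_(1 <= t < T.+1) lam T `^ (2 - p))).
  apply: ler_sum_nat => t /andP[t1 tT].
  by apply: ge0_ler_powR; rewrite ?nnegrE ?clip_level_ge0 ?subr_ge0 ?clip_level_incr.
rewrite sumr_const_nat subn1/= -[leLHS]mulr_natl.
rewrite [lam T `^ _]powRM ?mulr_ge0 ?powR_ge0 ?(ltW Bg_gt0)// [leLHS]mulrCA -powRrM.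
rewrite ler_wpM2l ?powR_ge0// -{1}[T%:R]powRr1// -!powR_natD//.
by rewrite kapE le_eqVlt; apply/orP; left; apply/eqP; congr (_ `^ _); field; rewrite gt_eqF.
Qed.

End schedule.

Lemma ler_sum_ord_const (R : numDomainType) n (F : 'I_n -> R) (c : R) :
  (forall i, F i <= c) -> \sum_i F i <= n%:R * c.
Proof.
move=> Fc; rewrite (le_trans (ler_sum _ (fun i _ => Fc i)))//.
by rewrite sumr_const card_ord mulr_natl.
Qed.

(** * Deterministic tracking bound *)

Section trajectory.
Context (R : realType) (N d : nat) (N_gt0 : (0 < N)%N).
Implicit Types (v : 'I_N -> 'rV[R]_d) (y z : 'rV[R]_d).

Let N_gt0' : 0 < N%:R :> R. Proof. by rewrite ltr0n. Qed.

(** Taken coordinatewise because the consensus estimate is scalar; it dominates the Euclidean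
    distances. *)
Definition diam v : R := \sum_k spread (fun i => v i 0 k).

Lemma diam_ge0 v : 0 <= diam v.
Proof. by apply: sumr_ge0 => k _; exact: spread_ge0. Qed.

Lemma enorm_sub_le_diam v i j : enorm (v i - v j) <= diam v.
Proof.
rewrite (le_trans (enorm_le_sum _))//; apply: ler_sum => k _.
by rewrite !mxE; exact: (abs_le_spread (fun i => v i 0 k)).
Qed.

Lemma enorm_average_le v (c : R) : (forall i, enorm (v i) <= c) ->
  enorm (average v) <= c.
Proof.
move=> vc; rewrite enormZ gtr0_norm ?invr_gt0// ler_pdivrMl//.
by rewrite (le_trans (ler_enorm_sum _))// ler_sum_ord_const.
Qed.

Lemma enorm_sub_average_le v i : enorm (v i - average v) <= diam v.
Proof.
rewrite (_ : v i - average v = average (fun j => v i - v j)).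
  by apply: enorm_average_le => j; exact: enorm_sub_le_diam.
rewrite /average sumrB sumr_const card_ord scalerBr -[v i *+ N]scaler_nat scalerA mulVf ?gt_eqF//.
by rewrite scale1r.
Qed.

(* The part of [enorm (y - z) ^+ 2 / 2] that depends on [y]: being affine in
   the comparator [z], it keeps the regret linear in the path length. *)
Definition potential z y : R := enorm y ^+ 2 / 2 - dotv y z.

Lemma potential_le z y (c : R) : enorm y <= c ->
  `|potential z y| <= c * (c + enorm z).
Proof.
move=> yc; have y0 := enorm_ge0 y; have z0 := enorm_ge0 z.
have c0 : 0 <= c by exact: le_trans yc.
rewrite (le_trans (ler_normB _ _))// mulrDr lerD//.
  rewrite ger0_norm ?divr_ge0 ?sqr_ge0// ler_pdivrMr//.
  have := ler_pM y0 y0 yc yc; rewrite -!expr2 => h.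
  by have := sqr_ge0 c; lra.
by rewrite (le_trans (dotv_abs_le _ _))// ler_wpM2r.
Qed.

Lemma potential_sub z z' y (c : R) : enorm y <= c ->
  potential z' y <= potential z y + c * enorm (z' - z).
Proof.
move=> yc; have : dotv y (z - z') <= c * enorm (z' - z).
  by rewrite enormBC (le_trans (dotv_le _ _))// ler_wpM2r// enorm_ge0.
by rewrite dotvBr /potential; lra.
Qed.

(** The three-point identity, with the square of the norm of [z] cancelled. *)
Lemma potential_step z y y' :
  dotv (y - y') (y - z) = potential z y - potential z y' + enorm (y - y') ^+ 2 / 2.
Proof.
by rewrite /potential !sqr_enorm !(dotvBl, dotvBr) (dotvC y' y); field.
Qed.

(** Each cost [h j] is moved from [v i] to the state [v j] of its own agent, where its gradient is
    controlled by [c]; at [v i], smoothness supplies the bound on the gradient. [L] has no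
    prescribed sign, hence [|L|]. *)
Lemma linearized_regret (h : 'I_N -> 'rV[R]_d -> R) v z (c L BX : R) :
  (forall i y, differentiable (h i) y) ->
  (forall i, convex_function [set: convex_lmodType 'rV[R]_d] (h i)) ->
  (forall i, L_smooth L (h i)) ->
  (forall i, enorm (v i) <= BX) ->
  (forall i, enorm (grad (h i) (v i)) <= c) ->
  \sum_i (\sum_j h j (v i) - \sum_j h j z) <=
    N%:R ^+ 2 * (c + `|L| * (2 * BX)) * diam v +
    N%:R * \sum_j dotv (grad (h j) (v j)) (v j - z).
Proof.
move=> hd hc hL vB gc.
have term i j : h j (v i) - h j z <=
    (c + `|L| * (2 * BX)) * diam v + dotv (grad (h j) (v j)) (v j - z).
  rewrite -(subrKA (h j (v j))) lerD//; last exact: (convex_grad _ (hd j _) (hc j)).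
  rewrite (le_trans (convex_grad _ (hd j _) (hc j)))//.
  rewrite (le_trans (dotv_le _ _))//.
  apply: ler_pM; rewrite ?enorm_ge0 ?enorm_sub_le_diam//.
  rewrite -[X in enorm X](subrK (grad (h j) (v j))).
  rewrite (le_trans (ler_enormD _ _))// addrC lerD//.
  rewrite (le_trans (hL j _ _))// (le_trans (ler_wpM2r (enorm_ge0 _) (ler_norm L)))//.
  rewrite ler_wpM2l// (le_trans (ler_enormB _ _))// mulr_natl mulr2n.
  by rewrite lerD.
apply: (@le_trans _ _ (\sum_(i < N) \sum_(j < N)
   ((c + `|L| * (2 * BX)) * diam v + dotv (grad (h j) (v j)) (v j - z)))).
  by apply: ler_sum => i _; rewrite -sumrB; apply: ler_sum => j _; exact: term.
rewrite sumr_const card_ord -[leLHS]mulr_natl big_split/= sumr_const card_ord.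
by rewrite -[_ * diam v *+ N]mulr_natl expr2 mulrDr !mulrA.
Qed.

Lemma path_length_ge0 (xs : nat -> 'rV[R]_d) T : 0 <= path_length xs T.
Proof. by apply: sumr_ge0 => t _; exact: enorm_ge0. Qed.

Lemma enorm_le_path_length (xs : nat -> 'rV[R]_d) t T : (1 <= t <= T)%N ->
  enorm (xs t) <= enorm (xs 1%N) + path_length xs T.
Proof.
move=> /andP[]; case: t => // t _ tT.
apply: (@le_trans _ _ (enorm (xs 1%N) + path_length xs t.+1)).
  elim: t tT => [|t IHt] tT; first by rewrite /path_length big_geq// addr0.
  rewrite /path_length big_nat_recr//= addrA -/(path_length xs t.+1).
  have := ler_enormD (xs t.+2 - xs t.+1) (xs t.+1); rewrite subrK.
  by have := IHt (ltnW tT); lra.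
rewrite lerD2l /path_length (@big_cat_nat _ _ _ t.+2 2 T.+1)//= lerDl.
by apply: sumr_ge0 => s _; exact: enorm_ge0.
Qed.

Context (W : nat -> 'M[R]_N) (E : nat -> rel 'I_N) (theta : R) (B : nat).
Context (theta_gt0 : 0 < theta) (theta_lt1 : theta < 1).
Context (A5 : network_assumption W E theta B).
Context (p Bg a b : R).
Context (p_gt1 : 1 < p) (Bg_gt0 : 0 < Bg).
Context (a_gt0 : 0 < a) (b_ge0 : 0 <= b).
Local Notation lam := (clip_level p Bg).
Local Notation eta := (step_size p a b).
Local Notation kap := ((1 + p) / (2 * p)).

(** One outcome of the algorithm, with arbitrary bounded directions [g] in place of the clipped
    gradients. *)
Definition clipped_trajectory (x1 : 'I_N -> 'rV[R]_d)
    (x g : 'I_N -> nat -> 'rV[R]_d) : Prop :=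
  [/\ forall i, x i 1%N = x1 i,
      forall i t, (1 <= t)%N ->
        x i t.+1 = \sum_j W t i j *: x j t - eta t *: g i t &
      forall i t, (1 <= t)%N -> enorm (g i t) <= lam t].

Lemma sum_diam x1 : exists2 C, 0 <= C & forall x g, clipped_trajectory x1 x g ->
  forall T, (1 <= T)%N -> \sum_(1 <= t < T.+1) diam (x^~ t) <= C * T%:R `^ 2^-1.
Proof.
have [C HC] := sum_spread theta_gt0 theta_lt1 A5 (diam x1)
  (drift_bound_ge0 p a Bg_gt0) (@drift_bound_anti _ p _ a Bg_gt0).
set c4 := 4 * Bg / a `^ ((p + 1) / (2 * p)).
have c4_ge0 : 0 <= c4 by rewrite !mulr_ge0 ?invr_ge0 ?powR_ge0// ltW.
exists (d%:R * (`|C| * (1 + c4))); first by rewrite !mulr_ge0// addr_ge0.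
move=> x g [x_init x_dyn gl] T T1; rewrite exchange_big/=.
rewrite -mulrA; apply: ler_sum_ord_const => k; rewrite -mulrA.
have T12 : 1 <= T%:R `^ 2^-1 :> R by apply: powR_nat_ge1.
apply: (@le_trans _ _ (C * (1 + \sum_(1 <= t < T.+1) drift_bound p Bg a t))).
  apply: (HC (fun t i => x i t 0 k)).
    move=> t i t1; rewrite x_dyn// !mxE summxE.
    under eq_bigr do rewrite mxE.
    rewrite addrAC subrr add0r normrN normrM gtr0_norm ?step_size_gt0//.
    rewrite (le_trans _ (drift_le p_gt1 Bg_gt0 a_gt0 b_ge0 t1))//.
    rewrite ler_wpM2l ?(ltW (step_size_gt0 _ _ _ _))//.
    exact: le_trans (coord_le_enorm _ _) (gl _ _ _).
  rewrite /diam (bigD1 k)//= (_ : (fun i => x i 1%N 0 k) = (fun i => x1 i 0 k)).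
    by rewrite lerDl; apply: sumr_ge0 => l _; exact: spread_ge0.
  by apply/funext => i; rewrite x_init.
have S0 : 0 <= \sum_(1 <= t < T.+1) drift_bound p Bg a t.
  by apply: sumr_ge0 => t _; exact: drift_bound_ge0.
apply: (@le_trans _ _ (`|C| * (1 + \sum_(1 <= t < T.+1) drift_bound p Bg a t))).
  by rewrite ler_wpM2r ?ler_norm// addr_ge0.
rewrite ler_wpM2l// mulrDl mul1r lerD//; exact: sum_drift.
Qed.

Section one_trajectory.
Context (x1 : 'I_N -> 'rV[R]_d) (x g : 'I_N -> nat -> 'rV[R]_d).
Context (xg : clipped_trajectory x1 x g).

Lemma average_step t : (1 <= t)%N ->
  average (x^~ t.+1) = average (x^~ t) - eta t *: average (g^~ t).
Proof.
move=> t1; have [_ x_dyn _] := xg; have [_ /(_ _ t1)[_ _ W1] _] := A5.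
rewrite /average; under eq_bigr do rewrite x_dyn//.
rewrite sumrB scalerBr exchange_big/=; congr (_ - _).
  by congr (_ *: _); apply: eq_bigr => j _; rewrite -scaler_suml W1 scale1r.
by rewrite -scaler_sumr !scalerA mulrC.
Qed.

(** Replacing each state by the average costs [lam t * diam]. By double stochasticity the average
    moves by exactly [eta t] times the average direction, to which [potential_step] applies. *)
Lemma inner_step z t : (1 <= t)%N ->
  \sum_j dotv (g j t) (x j t - z) <=
    N%:R * (lam t * diam (x^~ t)) + N%:R *
    ((eta t)^-1 * (potential z (average (x^~ t)) - potential z (average (x^~ t.+1)))
      + eta t * lam t ^+ 2).
Proof.
move=> t1; have [_ _ gl] := xg; set xb := average (x^~ t).
set xb' := average (x^~ t.+1).
have eta0 := step_size_gt0 p a_gt0 b_ge0 t1.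
have gavg : average (g^~ t) = (eta t)^-1 *: (xb - xb').
  by rewrite /xb' average_step// opprB subrKC scalerA mulVf ?gt_eqF// scale1r.
have -> : \sum_j dotv (g j t) (x j t - z) =
    \sum_j dotv (g j t) (x j t - xb) + N%:R * ((eta t)^-1 * dotv (xb - xb') (xb - z)).
  rewrite -dotvZl -gavg /average dotvZl mulrA divff ?gt_eqF// mul1r dotv_suml.
  rewrite -big_split; apply: eq_bigr => j _ /=.
  by rewrite -dotvDr addrA subrK.
apply: lerD.
  apply: ler_sum_ord_const => j.
  rewrite (le_trans (dotv_le _ _))// ler_pM ?enorm_ge0 ?gl//.
  exact: enorm_sub_average_le.
rewrite ler_wpM2l// potential_step mulrDr lerD2l.
have : enorm (xb - xb') <= eta t * lam t.
  rewrite /xb' average_step// opprB subrKC enormZ gtr0_norm// ler_wpM2l ?(ltW eta0)//.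
  by apply: enorm_average_le => i; exact: gl.
set e := enorm _ => el; have e0 : 0 <= e by exact: enorm_ge0.
rewrite ler_pdivrMl// mulrA -expr2 -exprMn.
have := ler_pM e0 e0 el el; rewrite -!expr2 => h.
by have := sqr_ge0 e; lra.
Qed.

End one_trajectory.

Lemma tracking_bound x1 BX (xs : nat -> 'rV[R]_d) : 0 < BX ->
  exists2 K, 0 <= K & forall x g, clipped_trajectory x1 x g ->
    (forall i t, (1 <= t)%N -> enorm (x i t) <= BX) ->
    forall T, (1 <= T)%N ->
    \sum_(1 <= t < T.+1) diam (x^~ t) <= K * T%:R `^ kap /\
    \sum_(1 <= t < T.+1) \sum_j dotv (g j t) (x j t - xs t)
      <= K * T%:R `^ kap * (1 + path_length xs T).
Proof.
move=> BX0; have [C C0 HC] := sum_diam x1.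
set ck := (a + b) `^ ((p + 1) / (2 * p)).
set c4 := 4 * Bg / a `^ ((p + 1) / (2 * p)).
have c4_ge0 : 0 <= c4 by rewrite !mulr_ge0 ?invr_ge0 ?powR_ge0// ltW.
(* Chosen so that [BX + enorm (xs t)] is at most [rho * (1 + path_length xs T)] for all rounds up to
   [T]. *)
set rho := BX + enorm (xs 1%N) + 1.
have rho1 : 1 <= rho by rewrite lerDr addr_ge0 ?enorm_ge0// ltW.
(* The summands pay, in order, for the sum of diameters, the consensus error, the telescoped
   potentials and the squared drifts. *)
pose K := C + N%:R * (2 * Bg * C) + N%:R * (ck * (2 * (BX * rho) + BX) + 2 * Bg * c4).
have ck0 : 0 <= ck by exact: powR_ge0.
have rho0 : 0 <= rho by exact: le_trans rho1.
have BX_ge0 := ltW BX0; have Bg_ge0 := ltW Bg_gt0.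
exists K; first by rewrite /K !(C0, c4_ge0, rho0, ck0, addr_ge0, mulr_ge0).
move=> x g xg xB T T1.
have Tk0 : 0 <= T%:R `^ kap :> R by exact: powR_ge0.
have PL := path_length_ge0 xs T.
have sD := HC _ _ xg _ T1.
have T12 : T%:R `^ 2^-1 <= T%:R `^ kap :> R.
  rewrite kapE// powR_natD// ler_peMl ?powR_ge0// powR_nat_ge1//.
  exact: ltW (alp_gt0 p_gt1).
split.
  rewrite (le_trans sD)// (le_trans (ler_wpM2l C0 T12))// ler_wpM2r//.
  by rewrite /K -addrA lerDl !(C0, c4_ge0, rho0, ck0, addr_ge0, mulr_ge0).
set D := \sum_(1 <= t < T.+1) diam _ in sD.
set Pot := \sum_(1 <= t < T.+1) ((eta t)^-1 * (potential (xs t) (average (x^~ t))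
  - potential (xs t) (average (x^~ t.+1)))).
have step1 : \sum_(1 <= t < T.+1) \sum_j dotv (g j t) (x j t - xs t) <=
    N%:R * (lam T * D) + N%:R * (Pot + lam T * \sum_(1 <= t < T.+1) drift_bound p Bg a t).
  rewrite /D /Pot !mulr_sumr -big_split/= mulr_sumr -big_split/=.
  apply: ler_sum_nat => t /andP[t1 tT].
  rewrite (le_trans (inner_step xg _ t1))// lerD//.
    by rewrite ler_wpM2l// ler_wpM2r ?diam_ge0// clip_level_incr.
  rewrite ler_wpM2l// lerD2l expr2 mulrA mulrC.
  apply: ler_pM; rewrite ?clip_level_ge0 ?clip_level_incr ?drift_le//.
  by rewrite mulr_ge0 ?clip_level_ge0// ltW// step_size_gt0.
have avgB t : (1 <= t)%N -> enorm (average (x^~ t)) <= BX.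
  by move=> t1; apply: enorm_average_le => i; exact: xB.
have PotB : Pot <= (eta T)^-1 * (2 * (BX * (rho * (1 + path_length xs T)))
    + BX * path_length xs T).
  rewrite /path_length mulr_sumr -/(path_length xs T).
  have zB t y : (1 <= t <= T)%N -> enorm y <= BX ->
      `|potential (xs t) y| <= BX * (rho * (1 + path_length xs T)).
    move=> tT yB; rewrite (le_trans (potential_le _ yB))// ler_wpM2l ?(ltW BX0)//.
    have := enorm_le_path_length xs tT; have := enorm_ge0 (xs 1%N).
    have := ler_wpM2r PL rho1; rewrite /rho; lra.
  rewrite /Pot; case: T T1 zB {Tk0 PL sD T12 D Pot step1} => // T _ zB.
  apply: (weighted_telescope
    (h := fun t => (eta t)^-1)
    (al := fun t => potential (xs t) (average (x^~ t)))
    (be := fun t => potential (xs t) (average (x^~ t.+1)))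
    (ga := fun t => BX * enorm (xs t - xs t.-1))).
  - by move=> t t1; rewrite invr_ge0 ltW// step_size_gt0.
  - by move=> t t1; exact: inv_step_size_incr.
  - by move=> t; rewrite mulr_ge0 ?enorm_ge0// ltW.
  - by move=> t /andP[t1 tT]; apply: zB; [rewrite t1|exact: avgB].
  - by apply: le_trans (ler_norm _) _; apply: zB => //; exact: avgB.
  - by move=> t /andP[t1 tT]; apply: potential_sub; exact: avgB.
apply: (le_trans step1).
have lsqrt (k : R) : 2 * Bg * k * T%:R `^ kap = lam T * (k * T%:R `^ 2^-1).
  by rewrite [RHS]mulrCA (clip_level_sqrt Bg p_gt1 T1); ring.
have lD : lam T * D <= 2 * Bg * C * T%:R `^ kap.
  by rewrite lsqrt ler_wpM2l ?clip_level_ge0.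
have lS : lam T * \sum_(1 <= t < T.+1) drift_bound p Bg a t <= 2 * Bg * c4 * T%:R `^ kap.
  by rewrite lsqrt ler_wpM2l ?clip_level_ge0// sum_drift.
have Pk : Pot <= ck * (2 * (BX * rho) + BX) * T%:R `^ kap * (1 + path_length xs T).
  apply: (le_trans PotB).
  apply: (@le_trans _ _ (ck * T%:R `^ kap *
     ((2 * (BX * rho) + BX) * (1 + path_length xs T)))); last first.
    by rewrite le_eqVlt; apply/orP; left; apply/eqP; ring.
  apply: ler_pM.
  - by rewrite invr_ge0 ltW// step_size_gt0.
  - by rewrite !(rho0, addr_ge0, mulr_ge0).
  - exact: inv_step_size_le.
  - by rewrite mulrDl [_ * (BX * _)]mulrC; have := BX0; lra.
set X := T%:R `^ kap in Tk0 lD lS Pk *; set Y := 1 + path_length xs T in Pk *.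
have XY : X <= X * Y by rewrite ler_peMr// lerDl.
have N0 := ltW N_gt0'.
have lD' : lam T * D <= 2 * Bg * C * (X * Y).
  by rewrite (le_trans lD)// ler_wpM2l// !mulr_ge0.
have lS' : lam T * \sum_(1 <= t < T.+1) drift_bound p Bg a t <= 2 * Bg * c4 * (X * Y).
  by rewrite (le_trans lS)// ler_wpM2l// !(c4_ge0, mulr_ge0).
rewrite -mulrA in Pk.
have CXY : 0 <= C * (X * Y) by rewrite mulr_ge0// (le_trans _ XY).
apply: le_trans (lerD (ler_wpM2l N0 lD') (ler_wpM2l N0 (lerD Pk lS'))) _.
by move: CXY; rewrite /K; clearbody c4 ck rho X Y; lra.
Qed.

End trajectory.

(** * Conditional moments of the noise *)

Section stochastic.
Context (R : realType) (disp : measure_display) (Omega : measurableType disp).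
Context (P : probability Omega R) (N d : nat).
Context (f : 'I_N -> nat -> 'rV[R]_d -> R) (xstar : nat -> 'rV[R]_d).
Context (W : nat -> 'M[R]_N).
Context (ghat : 'I_N -> nat -> 'rV[R]_d -> Omega -> 'rV[R]_d).
Context (x1 : 'I_N -> 'rV[R]_d) (x : 'I_N -> nat -> Omega -> 'rV[R]_d).
Context (sigma p L BX Bg a b : R).
Context (p_gt1 : 1 < p) (p_le2 : p <= 2) (Bg_gt0 : 0 < Bg) (BX_gt0 : 0 < BX).
Context (A1 : unbiased P f ghat x).
Context (A2 : heavy_tailed_noise P sigma p f ghat x).
Context (A3 : forall i t, (1 <= t)%N -> L_smooth L (f i t)).
Context (x_odcsgd : is_odcsgd W (clip_level p Bg) (step_size p a b) ghat x1 x).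
Local Notation lam := (clip_level p Bg).
Local Notation eta := (step_size p a b).
Local Notation "'Ex' X" := (\int[P]_w X w) (at level 10).

Definition noisy_grad i t w := ghat i t (x i t w) w.
Definition clipped_grad i t w := clip (lam t) (noisy_grad i t w).
Definition true_grad i t w := grad (f i t) (x i t w).

(** The generators of [past], named so that [g_sigma_algebraType] can express measurability with
    respect to F_t. *)
Definition past_events (t : nat) : set (set Omega) :=
  [set A | exists i s k, (1 <= s < t)%N /\
     preimage_set_system setT (fun w => ghat i s (x i s w) w 0 k) measurable A].

Local Notation FT t := (g_sigma_algebraType (past_events t)).

Lemma measurable_noisy i t k : (1 <= t)%N ->
  measurable_fun setT (fun w => noisy_grad i t w 0 k).
Proof. by move=> t1; have [_ /(_ k)[iX _ _ _]] := A1 i t1; exact: intg_meas iX. Qed.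

Lemma past_events_measurable t : past_events t `<=` measurable.
Proof.
move=> A [i [s [k [/andP[s1 _] [B mB <-]]]]].
exact: (measurable_noisy i k s1).
Qed.

Lemma past_measurable_funW t (U : Omega -> R) :
  measurable_fun (setT : set (FT t)) (U : FT t -> R) -> measurable_fun setT U.
Proof. by move=> mU; exact: (sub_measurable_fun (@past_events_measurable t) mU). Qed.

Lemma past_events_mono s t : (s <= t)%N -> past_events s `<=` past_events t.
Proof.
move=> st A [i [u [k [/andP[u1 us] h]]]]; exists i, u, k; split => //.
by rewrite u1 (leq_trans us).
Qed.

Lemma past_measurable_fun_mono s t (U : Omega -> R) : (s <= t)%N ->
  measurable_fun (setT : set (FT s)) (U : FT s -> R) ->
  measurable_fun (setT : set (FT t)) (U : FT t -> R).
Proof.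
move=> st mU _ B mB; have h := mU measurableT B mB.
apply: (sub_sigma_algebra2 (past_events_mono st)); exact: h.
Qed.

Lemma past_noisy i s t k : (1 <= s < t)%N ->
  measurable_fun (setT : set (FT t)) (fun w : FT t => noisy_grad i s w 0 k).
Proof.
move=> st _ B mB; apply: sub_sigma_algebra; exists i, s, k; split=> //.
by exists B.
Qed.

Lemma past_state t : (1 <= t)%N -> forall i,
  measurable_vec (fun w : FT t => x i t w).
Proof.
have [x_init x_dyn] := x_odcsgd; case: t => // t _; elim: t => [|t IHt] i k.
  rewrite (_ : (fun w => _) = cst (x1 i 0 k)); first exact: measurable_cst.
  by apply/funext => w; rewrite x_init.
rewrite (_ : (fun w => _) = (fun w : FT t.+2 => \sum_j W t.+1 i j * x j t.+1 w 0 k -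
    eta t.+1 * clipped_grad i t.+1 w 0 k)); last first.
  apply/funext => w; rewrite x_dyn// !mxE summxE; congr (_ - _).
  by apply: eq_bigr => j _; rewrite mxE.
apply: measurable_funB.
  apply: measurable_sum => j; apply: measurable_funM; first exact: measurable_cst.
  by apply: (past_measurable_fun_mono (leqnSn _)); exact: IHt.
apply: measurable_funM; first exact: measurable_cst.
apply: (measurable_clip (clip_level_ge0 p Bg_gt0 _)) => l.
by apply: past_noisy; rewrite leqnn.
Qed.

(** Read off [A1]: this gradient is a version of a conditional expectation given F_t. *)
Lemma past_true_grad i t : (1 <= t)%N -> measurable_vec (fun w : FT t => true_grad i t w).
Proof.
move=> t1 k _ B mB; have [_ /(_ k)[_ _ mY _]] := A1 i t1.
by have := mY B mB; rewrite setTI.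
Qed.

Lemma past_clipped i t : (1 <= t)%N ->
  measurable_vec (fun w : FT t.+1 => clipped_grad i t w).
Proof.
move=> t1; apply: (measurable_clip (clip_level_ge0 p Bg_gt0 _)) => l.
by apply: past_noisy; rewrite t1 ltnSn.
Qed.

Definition noise_term t w : R :=
  \sum_j dotv (true_grad j t w - clipped_grad j t w) (x j t w - xstar t).

Lemma past_noise_term t : (1 <= t)%N ->
  measurable_fun (setT : set (FT t.+1)) (noise_term t : FT t.+1 -> R).
Proof.
move=> t1; apply: measurable_sum => j; apply: measurable_dotv.
  apply: measurable_vecB; last exact: past_clipped.
  by move=> k; apply: (past_measurable_fun_mono (leqnSn _)); exact: past_true_grad.
apply: measurable_vecB; last by move=> k; exact: measurable_cst.
by move=> k; apply: (past_measurable_fun_mono (leqnSn _)); exact: past_state.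
Qed.

(** A bound for every outcome, thanks to clipping, whereas [A4] holds almost surely. It depends on
    [t] and serves integrability only, never the rate. *)
Lemma state_bounded t : (1 <= t)%N -> exists2 c, 0 <= c & forall i w, enorm (x i t w) <= c.
Proof.
have [x_init x_dyn] := x_odcsgd; case: t => // t _; elim: t => [|t [c c0 IHt]].
  exists (\sum_i enorm (x1 i)); first by apply: sumr_ge0 => i _; exact: enorm_ge0.
  move=> i w; rewrite x_init (bigD1 i)//= lerDl.
  by apply: sumr_ge0 => j _; exact: enorm_ge0.
exists (\sum_i \sum_j `|W t.+1 i j| * c + `|eta t.+1| * lam t.+1).
  apply: addr_ge0; last by apply: mulr_ge0 => //; exact: clip_level_ge0.
  by apply: sumr_ge0 => i _; apply: sumr_ge0 => j _; rewrite mulr_ge0.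
move=> i w; rewrite x_dyn// (le_trans (ler_enormB _ _))// lerD//; last first.
  by rewrite enormZ ler_wpM2l// enorm_clip_le// clip_level_gt0.
apply: (@le_trans _ _ (\sum_j `|W t.+1 i j| * c)).
  rewrite (le_trans (ler_enorm_sum _))//; apply: ler_sum => j _.
  by rewrite enormZ ler_wpM2l.
rewrite [leRHS](bigD1 i)//= lerDl; apply: sumr_ge0 => l _.
by apply: sumr_ge0 => j _; rewrite mulr_ge0.
Qed.

Lemma true_grad_bounded t : (1 <= t)%N ->
  exists2 c, 0 <= c & forall i w, enorm (true_grad i t w) <= c.
Proof.
move=> t1; have [c c0 xc] := state_bounded t1.
exists (`|L| * c + \sum_i enorm (grad (f i t) 0)).
  by rewrite addr_ge0 ?mulr_ge0//; apply: sumr_ge0 => i _; exact: enorm_ge0.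
move=> i w; rewrite -[X in enorm X](subrK (grad (f i t) 0)).
rewrite (le_trans (ler_enormD _ _))// lerD//.
  rewrite (le_trans (A3 _ t1 _ _))// subr0.
  rewrite (le_trans (ler_wpM2r (enorm_ge0 _) (ler_norm L)))// ler_wpM2l//.
rewrite (bigD1 i)//= lerDl; apply: sumr_ge0 => j _; exact: enorm_ge0.
Qed.

Lemma noise_term_bounded t : (1 <= t)%N ->
  exists2 c, 0 <= c & forall w, `|noise_term t w| <= c.
Proof.
move=> t1; have [c c0 xc] := state_bounded t1.
have [c' c'0 gc] := true_grad_bounded t1.
exists (N%:R * ((c' + lam t) * (c + enorm (xstar t)))).
  by rewrite !mulr_ge0 ?addr_ge0 ?clip_level_ge0 ?enorm_ge0.
move=> w; rewrite (le_trans (ler_norm_sum _ _ _))// ler_sum_ord_const// => j.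
rewrite (le_trans (dotv_abs_le _ _))// ler_pM ?enorm_ge0//.
  rewrite (le_trans (ler_enormB _ _))// lerD//.
  by rewrite enorm_clip_le// clip_level_gt0.
by rewrite (le_trans (ler_enormB _ _))// lerD.
Qed.

Context (A4 : bounded_assumption P BX Bg f x).

Definition good_outcome w := forall i t, (1 <= t)%N ->
  enorm (x i t w) <= BX /\ enorm (true_grad i t w) <= Bg.

Lemma good_outcome_ae : {ae P, forall w, good_outcome w}.
Proof. by apply: filterS A4 => w h i t t1; have [] := h i t t1. Qed.

Definition noise_pow j t w : R := enorm (noisy_grad j t w - true_grad j t w) `^ p.

(** The noise term without clipping; its conditional mean vanishes. *)
Definition linear_noise t w : R :=
  \sum_j dotv (true_grad j t w - noisy_grad j t w) (x j t w - xstar t).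

Section conditional_step.
Context (t : nat) (t1 : (1 <= t)%N) (V : Omega -> R) (c : R).
Context (mV : measurable_fun (setT : set (FT t)) (V : FT t -> R)).
Context (Vc : forall w, 0 <= V w <= c).

Let mV' : measurable_fun setT V.
Proof. exact: past_measurable_funW mV. Qed.

Let Vabs w : `|V w| <= c.
Proof. by have /andP[V0] := Vc w; rewrite ger0_norm. Qed.

Let iV : intg P V. Proof. exact: intg_bounded Vabs. Qed.

Lemma weighted_linear_noise :
  intg P (fun w => V w * linear_noise t w) /\
  Ex (fun w => V w * linear_noise t w) = 0.
Proof.
have [cx cx0 xc] := state_bounded t1.
(* [U] collects the factors known at the start of round [t]; for each agent and coordinate, [A1]
   exchanges the noisy and the true gradient against it. *)
pose U (jk : 'I_N * 'I_d) w := V w * (x jk.1 t w 0 jk.2 - xstar t 0 jk.2).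
pose D (jk : 'I_N * 'I_d) w :=
  U jk w * true_grad jk.1 t w 0 jk.2 - U jk w * noisy_grad jk.1 t w 0 jk.2.
have VE w : V w * linear_noise t w = \sum_jk D jk w.
  rewrite /linear_noise mulr_sumr.
  rewrite -(pair_big xpredT xpredT (fun j k => D (j, k) w))/=.
  apply: eq_bigr => j _; rewrite mulr_sumr; apply: eq_bigr => k _.
  by rewrite /D /U !mxE/=; ring.
have mU jk : measurable_fun (setT : set (FT t)) (U jk : FT t -> R).
  apply: measurable_funM; first exact: mV.
  apply: measurable_funB; last exact: measurable_cst.
  exact: past_state.
have Ub jk w : `|U jk w| <= c * (cx + enorm (xstar t)).
  rewrite normrM ler_pM// (le_trans (ler_normB _ _))// lerD ?coord_le_enorm//.
  by rewrite (le_trans (coord_le_enorm _ _)).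
have iD jk : intg P (D jk) /\ Ex (D jk) = 0.
  have [_ /(_ jk.2) hc] := A1 jk.1 t1; have [iX iY _ _] := hc.
  have mU' : measurable_fun setT (U jk).
    exact: past_measurable_funW (mU jk).
  have iUX := intg_boundedM mU' (Ub jk) iX.
  have iUY := intg_boundedM mU' (Ub jk) iY.
  split; first exact: intgB.
  rewrite RintegralB// (cond_exp_mul (@past_events_measurable t) hc (mU jk) (Ub jk)).
  by rewrite subrr.
split.
  under [X in intg _ X]funext do rewrite VE.
  by apply: intg_sum => jk; have [] := iD jk.
under eq_Rintegral do rewrite VE.
rewrite ex_sum => [|jk]; last by have [] := iD jk.
by rewrite big1// => jk _; have [] := iD jk.
Qed.

Lemma weighted_noise_pow j :
  intg P (fun w => V w * noise_pow j t w) /\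
  Ex (fun w => V w * noise_pow j t w) <= sigma `^ p * Ex V.
Proof.
have [_ [Y hc Ys]] := A2 j t1; have [iX iY _ _] := hc.
have iVX := intg_boundedM mV' Vabs iX; have iVY := intg_boundedM mV' Vabs iY.
split; first exact: iVX.
rewrite (cond_exp_mul (@past_events_measurable t) hc mV Vabs) -RintegralZl//.
apply: ex_le => //; first exact: intgZ.
apply: filterS Ys => w Yw; rewrite mulrC ler_wpM2r//.
by have /andP[] := Vc w.
Qed.

(** Used twice: with [V] the exponential of the past noise and [H] that of the new term, and with
    [V = 1] and [H] the noise term itself. *)
Lemma conditional_step H h0 mu kp : intg P (fun w => V w * H w) -> 0 <= kp ->
  {ae P, forall w, H w <= h0 + mu * linear_noise t w + kp * \sum_j noise_pow j t w} ->
  Ex (fun w => V w * H w) <= (h0 + kp * (N%:R * sigma `^ p)) * Ex V.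
Proof.
move=> iVH kp0 HB; have [iL EL] := weighted_linear_noise.
have iS j : intg P (fun w => V w * noise_pow j t w) by have [] := weighted_noise_pow j.
have iSum : intg P (fun w => \sum_j V w * noise_pow j t w) by exact: intg_sum.
apply: (@le_trans _ _ (Ex (fun w => h0 * V w + mu * (V w * linear_noise t w) +
    kp * \sum_j V w * noise_pow j t w))).
  apply: ex_le => //; first by apply: intgD; [apply: intgD|]; exact: intgZ.
  apply: filterS HB => w Hw; have /andP[V0 _] := Vc w.
  rewrite (le_trans (ler_wpM2l V0 Hw))// -mulr_sumr.
  by rewrite le_eqVlt; apply/orP; left; apply/eqP; ring.
rewrite RintegralD//; [|by apply: intgD; exact: intgZ|exact: intgZ].
rewrite RintegralD//; [|exact: intgZ|exact: intgZ].
rewrite !RintegralZl// EL mulr0 addr0 mulrDl lerD2l -mulrA ler_wpM2l//.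
rewrite ex_sum// -mulrA; apply: ler_sum_ord_const => j.
by have [] := weighted_noise_pow j.
Qed.

End conditional_step.

(** Inserting the noisy gradient splits the term into the unclipped noise and the clipping error,
    which [clip_bias] bounds. *)
Lemma noise_term_linear t r w : (1 <= t)%N -> good_outcome w ->
  BX + enorm (xstar t) <= r ->
  noise_term t w <= linear_noise t w +
    r * (lam t / 2) `^ (1 - p) * \sum_j noise_pow j t w.
Proof.
move=> t1 gw rB; rewrite /linear_noise mulr_sumr -big_split/=.
apply: ler_sum => j _; have [xB gB] := gw j t t1.
rewrite -(subrKA (noisy_grad j t w)) [leLHS]dotvDl lerD2l.
rewrite (le_trans (dotv_le _ _))// mulrC -mulrA ler_pM ?enorm_ge0//.
  by rewrite (le_trans (ler_enormB _ _))// (le_trans _ rB)// lerD2r.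
rewrite mulrC; apply: clip_bias => //; first exact: clip_level_gt0.
exact: le_trans gB (clip_level_ge p_gt1 Bg_gt0 t1).
Qed.

Lemma noise_term_abs t r w : (1 <= t)%N -> good_outcome w ->
  BX + enorm (xstar t) <= r -> `|noise_term t w| <= N%:R * (2 * lam t * r).
Proof.
move=> t1 gw rB; rewrite (le_trans (ler_norm_sum _ _ _))// ler_sum_ord_const// => j.
have [xB gB] := gw j t t1.
rewrite (le_trans (dotv_abs_le _ _))// ler_pM ?enorm_ge0//.
  rewrite (le_trans (ler_enormB _ _))//.
  have := enorm_clip_le (clip_level_gt0 p Bg_gt0 t1) (noisy_grad j t w).
  have := clip_level_ge p_gt1 Bg_gt0 t1; have := clip_level_ge0 p Bg_gt0 t.
  by rewrite /clipped_grad; lra.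
by rewrite (le_trans (ler_enormB _ _))// (le_trans _ rB)// lerD2r.
Qed.

Lemma noise_term_sqr t r w : (1 <= t)%N -> good_outcome w ->
  BX + enorm (xstar t) <= r ->
  noise_term t w ^+ 2 <= 4 * N%:R * r ^+ 2 * lam t `^ (2 - p) * \sum_j noise_pow j t w.
Proof.
move=> t1 gw rB.
pose e j := enorm (true_grad j t w - clipped_grad j t w).
have r0 : 0 <= r by rewrite (le_trans _ rB)// addr_ge0 ?enorm_ge0// ltW.
have ZB : `|noise_term t w| <= r * \sum_j e j.
  rewrite (le_trans (ler_norm_sum _ _ _))// mulr_sumr; apply: ler_sum => j _.
  rewrite (le_trans (dotv_abs_le _ _))// mulrC ler_pM ?enorm_ge0//.
  have [xB _] := gw j t t1.
  by rewrite (le_trans (ler_enormB _ _))// (le_trans _ rB)// lerD2r.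
have e0 j : 0 <= e j by exact: enorm_ge0.
have sum_sqr : (\sum_j e j) ^+ 2 <= N%:R * \sum_j e j ^+ 2.
  apply: (@le_trans _ _ (\sum_i \sum_j (e i ^+ 2 + e j ^+ 2) / 2)).
    rewrite expr2 mulr_suml; apply: ler_sum => i _; rewrite mulr_sumr.
    apply: ler_sum => j _; have := sqr_ge0 (e i - e j); lra.
  under eq_bigr do rewrite -mulr_suml big_split/= sumr_const card_ord.
  rewrite -mulr_suml big_split/= sumr_const card_ord sumrMnl.
  by rewrite -[_ *+ N]mulr_natl; lra.
rewrite -[leLHS]real_normK ?num_real//.
have := ler_pM (normr_ge0 _) (normr_ge0 _) ZB ZB; rewrite -!expr2 => /le_trans; apply.
rewrite exprMn.
apply: (@le_trans _ _ (r ^+ 2 * (N%:R * \sum_j (4 * (noise_pow j t w * lam t `^ (2 - p)))))).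
  rewrite ler_wpM2l ?sqr_ge0// (le_trans sum_sqr)// ler_wpM2l//.
  apply: ler_sum => j _; apply: clip_variance => //; first exact: clip_level_gt0.
  have [_ gB] := gw j t t1; exact: le_trans gB (clip_level_ge p_gt1 Bg_gt0 t1).
rewrite -mulr_sumr -mulr_suml.
by rewrite le_eqVlt; apply/orP; left; apply/eqP; ring.
Qed.

(** * Exponential moment, tail and mean of the accumulated noise *)

Definition noise_sum T w : R := \sum_(1 <= t < T.+1) noise_term t w.

Lemma past_noise_sum T :
  measurable_fun (setT : set (FT T.+1)) (noise_sum T : FT T.+1 -> R).
Proof.
elim: T => [|T IHT].
  rewrite (_ : noise_sum 0 = cst 0); first exact: measurable_cst.
  by apply/funext => w; rewrite /noise_sum big_geq.
rewrite (_ : noise_sum T.+1 = (fun w => noise_sum T w + noise_term T.+1 w)).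
  apply: measurable_funD; last exact: past_noise_term.
  by apply: (past_measurable_fun_mono (leqnSn _)); exact: IHT.
by apply/funext => w; rewrite /noise_sum [LHS]big_nat_recr.
Qed.

Lemma noise_sum_bounded T : exists2 c, 0 <= c & forall w, `|noise_sum T w| <= c.
Proof.
elim: T => [|T [c c0 IHT]].
  by exists 0 => // w; rewrite /noise_sum big_geq// normr0.
have [c' c'0 Zc] := noise_term_bounded (ltn0Sn T).
exists (c + c') => [|w]; first exact: addr_ge0.
rewrite /noise_sum big_nat_recr//= (le_trans (ler_normD _ _))// lerD//.
exact: IHT.
Qed.

Lemma exp_noise_bounded T mu : 0 <= mu ->
  exists c, forall w, 0 <= expR (mu * noise_sum T w) <= c.
Proof.
move=> mu0; have [c c0 Zc] := noise_sum_bounded T.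
exists (expR (mu * c)) => w; rewrite expR_ge0 ler_expR ler_wpM2l//.
exact: le_trans (ler_norm _) (Zc _).
Qed.

Lemma past_exp_noise T mu : measurable_fun (setT : set (FT T.+1))
  ((fun w => expR (mu * noise_sum T w)) : FT T.+1 -> R).
Proof.
apply: (measurableT_comp (@measurable_expR R)); apply: measurable_funM.
  exact: measurable_cst.
exact: past_noise_sum.
Qed.

Lemma intg_exp_noise T mu : 0 <= mu -> intg P (fun w => expR (mu * noise_sum T w)).
Proof.
move=> mu0; have [c Vc] := exp_noise_bounded T mu0.
apply: (@intg_bounded _ _ _ _ _ c).
  exact: past_measurable_funW (@past_exp_noise T mu).
by move=> w; have /andP[V0] := Vc w; rewrite ger0_norm.
Qed.

(* Coefficient of the noise moments in the bound on the conditional exponential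
   moment of [mu * noise_term t]: a bias term, of first order in [mu], and a
   variance term, of second order. *)
Definition noise_rate mu r t : R :=
  mu * (r * (lam t / 2) `^ (1 - p)) + 2 * mu ^+ 2 * (4 * N%:R * r ^+ 2 * lam t `^ (2 - p)).

(** Each round multiplies the moment by at most 1 + u <= exp(u), where u is [noise_rate] times the
    moment bound. The smallness hypothesis places [mu * noise_term] in the range of
    [expR_le_quadratic]. *)
Lemma exp_noise_moment T mu r : 0 <= mu ->
  (forall t, (1 <= t <= T)%N -> BX + enorm (xstar t) <= r) ->
  (forall t, (1 <= t <= T)%N -> mu * (N%:R * (2 * lam t * r)) <= 2^-1) ->
  Ex (fun w => expR (mu * noise_sum T w)) <=
    expR (\sum_(1 <= t < T.+1) noise_rate mu r t * (N%:R * sigma `^ p)).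
Proof.
move=> mu0; elim: T => [|T IHT] xr small.
  rewrite big_geq// expR0.
  under eq_Rintegral do rewrite /noise_sum big_geq// mulr0 expR0.
  by rewrite ex_cst.
have T1 : (1 <= T.+1)%N by [].
have r_ge : BX + enorm (xstar T.+1) <= r by apply: xr; rewrite ltnSn.
have r0 : 0 <= r by rewrite (le_trans _ r_ge)// addr_ge0 ?enorm_ge0// ltW.
have rate0 : 0 <= noise_rate mu r T.+1.
  by rewrite /noise_rate !(addr_ge0, mulr_ge0, powR_ge0, exprn_ge0).
have split_sum w : expR (mu * noise_sum T.+1 w) =
    expR (mu * noise_sum T w) * expR (mu * noise_term T.+1 w).
  by rewrite -expRD -mulrDr /noise_sum big_nat_recr.
under eq_Rintegral do rewrite split_sum.
have [c Vc] := exp_noise_bounded T mu0.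
rewrite (le_trans (conditional_step T1 (@past_exp_noise T mu) Vc (h0 := 1) (mu := mu)
  (kp := noise_rate mu r T.+1) _ rate0 _))//.
- under [X in intg _ X]funext do rewrite -split_sum.
  exact: intg_exp_noise.
- apply: filterS good_outcome_ae => w gw.
  have Zabs := noise_term_abs T1 gw r_ge.
  have muZ : mu * noise_term T.+1 w <= 2^-1.
    rewrite (le_trans (ler_wpM2l mu0 (ler_norm _)))//.
    by rewrite (le_trans (ler_wpM2l mu0 Zabs))// small// ltnSn.
  rewrite (le_trans (expR_le_quadratic muZ))//.
  have := ler_wpM2l mu0 (noise_term_linear T1 gw r_ge).
  have := ler_wpM2l (sqr_ge0 mu) (noise_term_sqr T1 gw r_ge).
  by rewrite /noise_rate exprMn; lra.
rewrite [X in expR X]big_nat_recr//= expRD mulrC ler_pM//.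
- by apply: Rintegral_ge0 => w _; exact: expR_ge0.
- by rewrite addr_ge0// !(rate0, mulr_ge0, powR_ge0).
- apply: IHT => t /andP[t1 tT]; [apply: xr|apply: small]; by rewrite t1 leqW.
- exact: expR_ge1Dx.
Qed.

Lemma noise_tail T mu r delta : 0 <= mu ->
  (forall t, (1 <= t <= T)%N -> BX + enorm (xstar t) <= r) ->
  (forall t, (1 <= t <= T)%N -> mu * (N%:R * (2 * lam t * r)) <= 2^-1) ->
  0 < delta ->
  (P [set w | (expR (\sum_(1 <= t < T.+1) noise_rate mu r t * (N%:R * sigma `^ p)) / delta
     <= expR (mu * noise_sum T w))%R] <= delta%:E)%E.
Proof.
move=> mu0 xr small delta0.
set S := expR (\sum_(1 <= t < T.+1) _).
have Sd0 : 0 < S / delta by rewrite divr_gt0// expR_gt0.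
apply: le_trans (ex_markov (intg_exp_noise T mu0) _ Sd0) _.
  by move=> w; exact: expR_ge0.
rewrite lee_fin ler_pdivrMr// mulrC divfK ?gt_eqF//.
exact: exp_noise_moment.
Qed.

Lemma intg_noise_sum T : intg P (noise_sum T).
Proof.
have [c _ Zc] := noise_sum_bounded T.
apply: (@intg_bounded _ _ _ _ _ c) => //.
exact: past_measurable_funW (@past_noise_sum T).
Qed.

Lemma noise_mean T r :
  (forall t, (1 <= t <= T)%N -> BX + enorm (xstar t) <= r) ->
  Ex (noise_sum T) <=
    \sum_(1 <= t < T.+1) r * (lam t / 2) `^ (1 - p) * (N%:R * sigma `^ p).
Proof.
elim: T => [|T IHT] xr.
  rewrite big_geq//; under eq_Rintegral do rewrite /noise_sum big_geq//.
  by rewrite ex_cst.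
have T1 : (1 <= T.+1)%N by [].
have r_ge : BX + enorm (xstar T.+1) <= r by apply: xr; rewrite ltnSn.
have r0 : 0 <= r by rewrite (le_trans _ r_ge)// addr_ge0 ?enorm_ge0// ltW.
have iZ : intg P (noise_term T.+1).
  have [c _ Zc] := noise_term_bounded T1; apply: (@intg_bounded _ _ _ _ _ c) => //.
  exact: past_measurable_funW (@past_noise_term _ T1).
under eq_Rintegral do rewrite /noise_sum big_nat_recr//=.
rewrite RintegralD//; last exact: intg_noise_sum.
rewrite big_nat_recr//= lerD//.
  by apply: IHT => t /andP[t1 tT]; apply: xr; rewrite t1 leqW.
have one : measurable_fun (setT : set (FT T.+1)) (cst 1 : FT T.+1 -> R).
  exact: measurable_cst.
have one01 w : 0 <= (cst 1 : Omega -> R) w <= 1 by rewrite /= ler01 lexx.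
have Z1 : (fun w => (cst 1 : Omega -> R) w * noise_term T.+1 w) = noise_term T.+1.
  by apply/funext => w; rewrite mul1r.
have := conditional_step T1 one one01 (H := noise_term T.+1) (h0 := 0) (mu := 1)
  (kp := r * (lam T.+1 / 2) `^ (1 - p)).
rewrite Z1 ex_cst mulr1 add0r; apply => //.
  by rewrite mulr_ge0 ?powR_ge0.
apply: filterS good_outcome_ae => w gw.
by rewrite add0r mul1r; exact: noise_term_linear.
Qed.

(** * From the noise to the regret *)

Context (N_gt0 : (0 < N)%N) (a_gt0 : 0 < a) (b_ge0 : 0 <= b).
Context (f_diff : forall i t z, (1 <= t)%N -> differentiable (f i t) z).
Context (f_convex : forall i t, (1 <= t)%N ->
  convex_function [set: convex_lmodType 'rV[R]_d] (f i t)).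
Context (E : nat -> rel 'I_N) (theta : R) (B : nat).
Context (theta_gt0 : 0 < theta) (theta_lt1 : theta < 1).
Context (A5 : network_assumption W E theta B).
Local Notation kap := ((1 + p) / (2 * p)).
Local Notation alp := (1 / (2 * p)).

Definition regret T w : R := dynamic_regret f xstar (fun i t => x i t w) T.

Lemma measurable_regret T : measurable_fun setT (regret T).
Proof.
have fx_meas i j t : (1 <= t)%N -> measurable_fun setT (fun w => f j t (x i t w)).
  move=> t1; apply: measurable_continuous_vec.
    by move=> z; apply: differentiable_continuous; exact: f_diff.
  by move=> k; apply: past_measurable_funW; exact: past_state.
apply: measurable_sum => i.
rewrite (_ : (fun w => _) = fun w => \sum_(t < T)
    (total_cost f t.+1 (x i t.+1 w) - total_cost f t.+1 (xstar t.+1))).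
  apply: measurable_sum => t; apply: measurable_funB; last exact: measurable_cst.
  by apply: measurable_sum => j; exact: fx_meas.
by apply/funext => w; rewrite big_add1 big_mkord.
Qed.

Lemma state_trajectory w : clipped_trajectory W p Bg a b x1
  (fun i t => x i t w) (fun i t => clipped_grad i t w).
Proof.
have [x_init x_dyn] := x_odcsgd; split=> [i|i t t1|i t t1].
- exact: x_init.
- exact: x_dyn.
- by apply: enorm_clip_le; exact: clip_level_gt0.
Qed.

Lemma pathwise_regret : exists2 K, 0 <= K & forall w, good_outcome w ->
  forall T, (1 <= T)%N ->
  regret T w <= N%:R * noise_sum T w + K * (T%:R `^ kap * (1 + path_length xstar T)).
Proof.
have [K K0 HK] := tracking_bound N_gt0 theta_gt0 theta_lt1 A5 p_gt1 Bg_gt0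
  a_gt0 b_ge0 x1 xstar BX_gt0.
set c := N%:R ^+ 2 * (Bg + `|L| * (2 * BX)).
have c0 : 0 <= c.
  by rewrite mulr_ge0 ?exprn_ge0// addr_ge0 ?mulr_ge0// ltW.
exists (c * K + N%:R * K); first by rewrite addr_ge0// mulr_ge0.
move=> w gw T T1.
have [sD sI] := HK _ _ (state_trajectory w) (fun i t t1 => (gw i t t1).1) T T1.
have round t : (1 <= t)%N ->
    \sum_i (total_cost f t (x i t w) - total_cost f t (xstar t)) <=
    c * diam (fun i => x i t w) + N%:R * (noise_term t w +
      \sum_j dotv (clipped_grad j t w) (x j t w - xstar t)).
  move=> t1; rewrite /noise_term -big_split/=.
  (* The clipping error and the clipped gradient add up to the true gradient. *)
  under [X in _ <= _ + _ * X]eq_bigr do rewrite -dotvDl subrK.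
  apply: (linearized_regret (h := fun i => f i t) (v := fun i => x i t w)).
  - by move=> i y; exact: f_diff.
  - by move=> i; exact: f_convex.
  - by move=> i; exact: A3.
  - by move=> i; have [] := gw i t t1.
  - by move=> i; have [] := gw i t t1.
rewrite /regret /dynamic_regret exchange_big/=.
apply: (@le_trans _ _ (\sum_(1 <= t < T.+1) (c * diam (fun i => x i t w) +
    N%:R * (noise_term t w + \sum_j dotv (clipped_grad j t w) (x j t w - xstar t))))).
  by apply: ler_sum_nat => t /andP[t1 _]; exact: round.
rewrite big_split/= -!mulr_sumr big_split/= -/(noise_sum T w).
have PL := path_length_ge0 xstar T.
have XY : T%:R `^ kap <= T%:R `^ kap * (1 + path_length xstar T).
  by rewrite ler_peMr ?powR_ge0// lerDl.
have := ler_wpM2l c0 (le_trans sD (ler_wpM2l K0 XY)).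
have := ler_wpM2l (ler0n R N) sI.
by lra.
Qed.

(** The costs at the minimizers cancel in the difference, so only bounded states and gradients
    remain and the path length disappears. *)
Lemma regret_gap w w' T : good_outcome w -> good_outcome w' ->
  regret T w <= regret T w' +
    T%:R * (N%:R * (N%:R * ((Bg + `|L| * (2 * BX)) * (2 * BX)))).
Proof.
move=> gw gw'; rewrite addrC -lerBlDr /regret /dynamic_regret exchange_big/=.
rewrite [X in _ - X]exchange_big/= -sumrB big_add1 big_mkord.
apply: ler_sum_ord_const => t; rewrite -sumrB; apply: ler_sum_ord_const => i.
rewrite opprB addrA subrK -sumrB; apply: ler_sum_ord_const => j.
have t1 : (1 <= t.+1)%N by [].
have [xB _] := gw i _ t1; have [xB' _] := gw' i _ t1; have [jB gB] := gw j _ t1.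
rewrite (le_trans (convex_grad _ (f_diff j _ t1) (f_convex j t1)))//.
rewrite (le_trans (dotv_le _ _))// ler_pM ?enorm_ge0//.
  rewrite -[X in enorm X](subrK (true_grad j t.+1 w)).
  rewrite (le_trans (ler_enormD _ _))// addrC lerD//.
  rewrite (le_trans (A3 _ t1 _ _))// (le_trans (ler_wpM2r (enorm_ge0 _) (ler_norm L)))//.
  by rewrite ler_wpM2l// (le_trans (ler_enormB _ _))// mulr_natl mulr2n lerD.
by rewrite (le_trans (ler_enormB _ _))// mulr_natl mulr2n lerD.
Qed.

Let rho := BX + enorm (xstar 1) + 1.
Let moment := N%:R * sigma `^ p.

Let rho_ge1 : 1 <= rho.
Proof. by rewrite lerDr addr_ge0 ?enorm_ge0// ltW. Qed.

Let rho_ge0 : 0 <= rho. Proof. exact: le_trans rho_ge1. Qed.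

Let moment_ge0 : 0 <= moment. Proof. by rewrite mulr_ge0 ?powR_ge0. Qed.

Lemma minimizer_radius T t : (1 <= t <= T)%N ->
  BX + enorm (xstar t) <= rho * (1 + path_length xstar T).
Proof.
move=> tT; have := enorm_le_path_length xstar tT.
have := ler_wpM2r (path_length_ge0 xstar T) rho_ge1; rewrite /rho; lra.
Qed.

Lemma sum_noise_rate T mu Y : (1 <= T)%N -> 0 <= mu -> 0 <= Y ->
  Y <= T%:R `^ (2^-1 - alp) ->
  \sum_(1 <= t < T.+1) noise_rate mu (rho * Y) t <=
    mu * (rho * (2 * Bg `^ (1 - p)) +
      8 * (mu * T%:R `^ kap) * N%:R * rho ^+ 2 * (2 * Bg) `^ (2 - p)) *
    (T%:R `^ kap * Y).
Proof.
move=> T1 mu0 Y0 YT.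
(* This absorbs the excess factor T^alp of the variance together with one of the two factors [Y]. *)
have YX : Y * T%:R `^ alp <= T%:R `^ kap.
  apply: le_trans (ler_wpM2r (powR_ge0 _ _) YT) _.
  by rewrite -powR_natD// ler_powR ?ler1n// subrK kapE// lerDr ltW ?alp_gt0.
rewrite /noise_rate big_split/= -!mulr_sumr.
have r0 : 0 <= mu * (rho * Y) by rewrite !mulr_ge0.
have q0 : 0 <= 2 * mu ^+ 2 * (4 * N%:R * (rho * Y) ^+ 2).
  by rewrite !(mulr_ge0, exprn_ge0).
have := ler_wpM2l r0 (sum_bias p_gt1 Bg_gt0 T1).
have := ler_wpM2l q0 (sum_variance p_gt1 p_le2 Bg_gt0 T1).
have z0 : 0 <= 8 * mu ^+ 2 * N%:R * rho ^+ 2 * (2 * Bg) `^ (2 - p) * (T%:R `^ kap * Y).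
  by rewrite !(mulr_ge0, exprn_ge0, powR_ge0).
have := ler_wpM2l z0 YX.
set U := \sum_(1 <= t < T.+1) lam t `^ (2 - p).
set V := \sum_(1 <= t < T.+1) (lam t / 2) `^ (1 - p).
move: (T%:R `^ kap) (T%:R `^ alp) ((2 * Bg) `^ (2 - p)) (Bg `^ (1 - p)) => X A c1 c2.
by lra.
Qed.

Lemma noise_sum_high_prob : exists2 C, 0 <= C & forall T delta Y, (1 <= T)%N ->
  0 < delta -> delta < 1 -> Y = 1 + path_length xstar T ->
  Y <= T%:R `^ (2^-1 - alp) ->
  exists D : set Omega, [/\ measurable D, (P D <= delta%:E)%E &
    forall w, ~ D w -> noise_sum T w <= C * (T%:R `^ kap * (Y + ln (1 / delta)))].
Proof.
have rho0 : 0 < rho by exact: lt_le_trans rho_ge1.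
have N0 : 0 < N%:R :> R by rewrite ltr0n.
(* With [mu = m0 / T^kap], the bound on [mu * noise_term] comes out as exactly 1/2. *)
pose m0 := (8 * N%:R * Bg * rho)^-1.
have m0_gt0 : 0 < m0 by rewrite invr_gt0 !mulr_gt0.
pose C1 := rho * (2 * Bg `^ (1 - p)) + 8 * m0 * N%:R * rho ^+ 2 * (2 * Bg) `^ (2 - p).
have C1_ge0 : 0 <= C1.
  by rewrite addr_ge0 ?mulr_ge0 ?powR_ge0 ?exprn_ge0// ltW.
exists (moment * C1 + m0^-1).
  by apply: addr_ge0; [exact: mulr_ge0|rewrite invr_ge0 ltW].
move=> T delta Y T1 delta0 delta1 YE YT.
have PL := path_length_ge0 xstar T.
have Y1 : 1 <= Y by rewrite YE lerDl.
have Y0 : 0 <= Y by exact: le_trans Y1.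
set X := T%:R `^ kap; have X0 : 0 < X by rewrite powR_gt0// ltr0n.
pose mu := m0 / X; have mu0 : 0 < mu by rewrite divr_gt0.
have muX : mu * X = m0 by rewrite divfK ?gt_eqF.
have xr t : (1 <= t <= T)%N -> BX + enorm (xstar t) <= rho * Y.
  by move=> tT; rewrite YE; exact: minimizer_radius.
have small t : (1 <= t <= T)%N -> mu * (N%:R * (2 * lam t * (rho * Y))) <= 2^-1.
  move=> /andP[t1 tT].
  have lX : lam t * Y <= 2 * Bg * X.
    apply: (@le_trans _ _ (lam T * T%:R `^ (2^-1 - alp))).
      by rewrite ler_pM ?clip_level_ge0 ?clip_level_incr.
    rewrite /clip_level -mulrA -powR_natD// subrKC ler_wpM2l ?mulr_ge0 ?(ltW Bg_gt0)//.
    by rewrite /X ler_powR ?ler1n// kapE// lerDr ltW ?alp_gt0.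
  have -> : 2^-1 = mu * (N%:R * 2 * rho) * (2 * Bg * X).
    rewrite (_ : _ * (2 * Bg * X) = (mu * X) * (4 * N%:R * Bg * rho)); last by ring.
    by rewrite muX /m0; field; rewrite !gt_eqF.
  have h0 : 0 <= mu * (N%:R * 2 * rho).
    by apply: mulr_ge0; [exact: ltW|rewrite !mulr_ge0].
  by have := ler_wpM2l h0 lX; lra.
set S := \sum_(1 <= t < T.+1) noise_rate mu (rho * Y) t * moment.
exists [set w | expR S / delta <= expR (mu * noise_sum T w)]; split.
- rewrite -[X in measurable X]setTI; apply: measurable_fun_le => //.
  exact: past_measurable_funW (@past_exp_noise T mu).
- exact: noise_tail (ltW mu0) xr small delta0.
move=> w /negP; rewrite -ltNge => small_w.
have : mu * noise_sum T w < S + ln (1 / delta).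
  rewrite -ltr_expR expRD lnK ?posrE ?divr_gt0//.
  by rewrite mul1r.
have SB : S <= mu * (moment * C1 * (X * Y)).
  rewrite /S -mulr_suml.
  have := sum_noise_rate T1 (ltW mu0) Y0 YT; rewrite -/X muX -/C1 => h.
  by have := ler_wpM2r moment_ge0 h; lra.
have ln0 : 0 <= ln (1 / delta) by rewrite ln_ge0// mul1r invf_ge1// ltW.
have lnE : ln (1 / delta) = mu * (m0^-1 * (X * ln (1 / delta))).
  by rewrite /mu; field; rewrite !gt_eqF.
move=> h; have {h SB} : mu * noise_sum T w <= mu * (moment * C1 * (X * Y) +
    m0^-1 * (X * ln (1 / delta))).
  by rewrite [leRHS]mulrDr -lnE; apply: le_trans (ltW h) _; rewrite lerD2r.
rewrite ler_pM2l// => /le_trans; apply.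
have e1 : 0 <= moment * C1 * (X * ln (1 / delta)).
  by apply: mulr_ge0; apply: mulr_ge0 => //; exact: ltW.
have e2 : 0 <= m0^-1 * (X * Y).
  by apply: mulr_ge0; [rewrite invr_ge0 ltW|rewrite mulr_ge0// ltW].
by lra.
Qed.

(** If every good outcome exceeded the bound, so would the mean, against [noise_mean]. The added 1
    in the constant makes this strict, as [X * Y >= 1]. *)
Lemma noise_sum_typical : exists2 C, 0 <= C & forall T, (1 <= T)%N ->
  exists2 w, good_outcome w &
    noise_sum T w <= C * (T%:R `^ kap * (1 + path_length xstar T)).
Proof.
exists (moment * (rho * (2 * Bg `^ (1 - p))) + 1).
  by rewrite addr_ge0 ?mulr_ge0 ?powR_ge0// ltW.
move=> T T1; apply: contrapT => none.
have PL := path_length_ge0 xstar T.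
set X := T%:R `^ kap; set Y := 1 + path_length xstar T.
have Y1 : 1 <= Y by rewrite lerDl.
have X1 : 1 <= X by rewrite powR_nat_ge1// divr_ge0 ?addr_ge0 ?mulr_ge0// ltW// (lt_trans _ p_gt1).
have XY : 1 <= X * Y by rewrite (le_trans X1)// ler_peMr// (le_trans _ X1).
have big_noise : {ae P, forall w,
    (moment * (rho * (2 * Bg `^ (1 - p))) + 1) * (X * Y) <= noise_sum T w}.
  apply: filterS good_outcome_ae => w gw; rewrite leNgt; apply/negP => lt.
  by apply: none; exists w => //; exact: ltW.
have icst : intg P (fun=> (moment * (rho * (2 * Bg `^ (1 - p))) + 1) * (X * Y)).
  exact: finite_measure_integrable_cst.
have := ex_le icst (intg_noise_sum T) big_noise; rewrite ex_cst => lo.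
have hi := noise_mean (fun t => @minimizer_radius T t).
have r0 : 0 <= rho * Y * moment.
  by apply: mulr_ge0 => //; apply: mulr_ge0 => //; exact: le_trans Y1.
have := ler_wpM2l r0 (sum_bias p_gt1 Bg_gt0 T1); rewrite mulr_sumr => sb.
have : \sum_(1 <= t < T.+1) rho * Y * (lam t / 2) `^ (1 - p) * moment =
    \sum_(1 <= t < T.+1) rho * Y * moment * (lam t / 2) `^ (1 - p).
  by apply: eq_bigr => t _; rewrite mulrAC.
move=> e; rewrite -/moment -/Y e in hi.
by have := le_trans lo (le_trans hi sb); rewrite -/X; lra.
Qed.

(* The noise contributes [<sum of errors, xstar>], of size about
   [path_length xstar T * T%:R `^ alp * ln (1 / delta)] in the worst case, which is
   affordable only while [path_length xstar T] is at most [T%:R `^ (1 - kap)].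
   Beyond that, the claimed bound exceeds [T%:R], while the regrets of two bounded
   trajectories differ by [O(T)], so one outcome with small noise suffices. *)
Lemma regret_high_prob : exists K, forall T delta, (1 <= T)%N ->
  0 < delta -> delta < 1 ->
  ((1 - delta)%R%:E <= P [set w | (regret T w <= K * T%:R `^ kap *
     (1 + path_length xstar T + ln (1 / delta)))%R])%E.
Proof.
have [K1 K1_ge0 HK1] := pathwise_regret.
have [C C_ge0 HC] := noise_sum_high_prob.
have [C' C'_ge0 HC'] := noise_sum_typical.
pose c := N%:R * (N%:R * ((Bg + `|L| * (2 * BX)) * (2 * BX))).
have c_ge0 : 0 <= c by rewrite !mulr_ge0 ?addr_ge0 ?mulr_ge0// ltW.
pose K := N%:R * C + N%:R * C' + K1 + c.
exists K => T delta T1 delta0 delta1.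
have PL := path_length_ge0 xstar T.
set X := T%:R `^ kap; set Y := 1 + path_length xstar T.
have Y1 : 1 <= Y by rewrite lerDl.
have Y0 : 0 <= Y by exact: le_trans Y1.
have X0 : 0 <= X by exact: powR_ge0.
set l := ln (1 / delta).
have l0 : 0 <= l by rewrite ln_ge0// mul1r invf_ge1// ltW.
have XYl : 0 <= X * (Y + l) by rewrite mulr_ge0// addr_ge0.
have XY_le : X * Y <= X * (Y + l) by rewrite ler_wpM2l// lerDl.
have XY0 : 0 <= X * Y by rewrite mulr_ge0.
have N0 : 0 <= N%:R :> R by [].
have mQ : measurable [set w | regret T w <= K * X * (Y + l)].
  rewrite -[X in measurable X]setTI; apply: measurable_fun_le => //.
  exact: measurable_regret.
have [A [mA PA goodA]] := good_outcome_ae.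
have goodP w : ~ A w -> good_outcome w.
  by move=> Aw; apply: contrapT => bad; apply: Aw; exact: goodA.
have [YT|TY] := leP Y (T%:R `^ (2^-1 - alp)).
  have [D [mD PD HD]] := HC T delta Y T1 delta0 delta1 erefl YT.
  apply: (probability_ge_cover mA mD mQ PA PD) => w /= Qw.
  apply: contrapT => /not_orP[Aw Dw]; apply: Qw.
  apply: (le_trans (HK1 w (goodP w Aw) T T1)).
  have := ler_wpM2l N0 (HD w Dw); have := ler_wpM2l K1_ge0 XY_le.
  have := mulr_ge0 c_ge0 XYl; have := mulr_ge0 (mulr_ge0 N0 C'_ge0) XYl.
  by rewrite /K -/X -/Y -/l; lra.
have [w' gw' nw'] := HC' T T1.
(* Here the regret bound holds on every good outcome, so the exceptional event is empty. *)
apply: (@probability_ge_cover _ _ _ _ A set0 _ delta) => //.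
  by rewrite measure0 lee_fin ltW.
move=> w /= Qw; left; apply: contrapT => Aw; apply: Qw.
have TXY : T%:R <= X * Y.
  apply: le_trans (_ : X * T%:R `^ (2^-1 - alp) <= _); last by rewrite ler_wpM2l// ltW.
  rewrite /X -powR_natD// kapE// (_ : alp + 2^-1 + (2^-1 - alp) = 1) ?powRr1//.
  by lra.
apply: (le_trans (regret_gap T (goodP w Aw) gw')).
have := HK1 w' gw' T T1; rewrite -/X -/Y -/c.
have := ler_wpM2l N0 nw'; have := ler_wpM2l K1_ge0 XY_le.
have := ler_wpM2r c_ge0 TXY; have := ler_wpM2l c_ge0 XY_le.
have := ler_wpM2l (mulr_ge0 N0 C'_ge0) XY_le; have := mulr_ge0 (mulr_ge0 N0 C_ge0) XYl.
by rewrite /K -/X -/Y; lra.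
Qed.

End stochastic.

Theorem corollary1
  (R : realType) (disp : measure_display) (Omega : measurableType disp)
  (P : probability Omega R) (N d : nat)
  (f : 'I_N -> nat -> 'rV[R]_d -> R) (xstar : nat -> 'rV[R]_d)
  (W : nat -> 'M[R]_N) (E : nat -> rel 'I_N)
  (ghat : 'I_N -> nat -> 'rV[R]_d -> Omega -> 'rV[R]_d)
  (x1 : 'I_N -> 'rV[R]_d) (x : 'I_N -> nat -> Omega -> 'rV[R]_d)
  (sigma p L BX Bg theta a b : R) (B : nat)
  (N_gt0 : (0 < N)%N)
  (f_diff : forall i t z, (1 <= t)%N -> differentiable (f i t) z)
  (f_convex : forall i t, (1 <= t)%N ->
     convex_function [set: convex_lmodType 'rV[R]_d] (f i t))
  (xstar_min : forall t, (1 <= t)%N -> is_minimizer (total_cost f t) (xstar t))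
  (sigma_gt0 : 0 < sigma) (p_gt1 : 1 < p) (p_le2 : p <= 2)
  (BX_gt0 : 0 < BX) (Bg_gt0 : 0 < Bg)
  (theta_gt0 : 0 < theta) (theta_lt1 : theta < 1) (B_gt0 : (0 < B)%N)
  (a_gt0 : 0 < a) (b_ge0 : 0 <= b)
  (A1 : unbiased P f ghat x)
  (A2 : heavy_tailed_noise P sigma p f ghat x)
  (A3 : forall i t, (1 <= t)%N -> L_smooth L (f i t))
  (A4 : bounded_assumption P BX Bg f x)
  (A5 : network_assumption W E theta B)
  (x_odcsgd : is_odcsgd W
     (fun t => 2 * Bg * t%:R `^ (1 / (2 * p)))
     (fun t => 1 / (a * t%:R + b) `^ ((p + 1) / (2 * p)))
     ghat x1 x) :
  exists K : R, forall (T : nat) (delta : R),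
    (1 <= T)%N -> 0 < delta -> delta < 1 ->
    ((1 - delta)%R%:E <=
      P [set w | (dynamic_regret f xstar (fun i t => x i t w) T
           <= K * T%:R `^ ((1 + p) / (2 * p))
                * (1 + path_length xstar T + ln (1 / delta)))%R])%E.
Proof.
exact: (regret_high_prob xstar p_gt1 p_le2 Bg_gt0 BX_gt0 A1 A2 A3 x_odcsgd A4 N_gt0
  a_gt0 b_ge0 f_diff f_convex theta_gt0 theta_lt1 A5).
Qed.
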